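(* Let $g_{\mathfrak{d}}\in\mathfrak{g}_n^{\parallel}$ be the Lie algebra element attached to a wall $\mathfrak{d}$ with direction $-n$. For any $\alpha\in\widehat{A}$, $$(\exp\mathrm{ad}_{g_{\mathfrak{d}}})_*(\alpha)=(\exp\mathrm{ad}_{g_{\mathfrak{d}}})(\alpha),$$ i.e. the pushforward of the polyvector field $\alpha$ along the wall-crossing automorphism $\exp\mathrm{ad}_{g_{\mathfrak{d}}}$ of $\widehat A^{-1}=R(\!(P)\!)$ equals the result of applying to $\alpha$ the exponential of the adjoint action of $g_{\mathfrak{d}}$ for the Schouten–Nijenhuis bracket. Hence, gluing elements of $\widehat{A}$ via these extended wall-crossing automorphisms produces meromorphic sections of the sheaf of polyvector fields on $\mathcal{X}$.
   Context: $N$ is a lattice of finite rank, $M=\mathrm{Hom}(N,\mathbb{Z})$, $N_{\mathbb{R}}=N\otimes\mathbb{R}$, $R$ is a commutative ring, and $P\subset N$ is the set of integral points of a strictly convex cone in $N_{\mathbb{R}}$. $R[\![P]\!]$ is the completion of $R[P]$ with respect to its monomial maximal ideal, $R(\!(P)\!)=\bigcup_{n\in N}z^nR[\![P]\!]$, and $\widehat{A}=\bigcup_{n\in N}z^nR[\![P]\!]\otimes\Lambda^*M$ is the ring of Laurent series of polyvector fields on the algebraic torus $\mathrm{Spec}\,R[N]$. Gradings: $\deg(z^n\alpha)=d$ for $\alpha\in\Lambda^dM$, $|z^n\alpha|=d-1$; $\widehat{A}^d$ is the part with $|\cdot|=d$, so $\widehat{A}^{-1}=R(\!(P)\!)$ and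 $\widehat{A}^0$ consists of vector fields, with $z^n\otimes m$ acting by $z^a\mapsto\langle a,m\rangle z^{a+n}$. Let $l_1(z^n\alpha)=z^n\iota_n(\alpha)$ (extended to $\widehat A$), with $\iota_n$ the contraction, and let $\mathfrak{g}=\widehat{A}^0\cap\ker(l_1)$, a Lie algebra under the bracket of vector fields. $[\cdot,\cdot]$ is the Schouten–Nijenhuis bracket on $\widehat{A}$: the unique extension of the Lie bracket/Lie derivative of vector fields to a graded bracket making $\widehat{A}$ a Gerstenhaber algebra (for a vector field $v$ and a function $f$, $[v,f]=v(f)$); $\mathrm{ad}_a(b)=[a,b]$. For $n\in P$, $\mathfrak{g}_n^{\parallel}\subset\mathfrak{g}$ is the Lie subalgebra topologically spanned by elements (of $\mathfrak{g}$) of the form $z^{kn}\otimes m$, $k\in\mathbb{Z}_{\ge1}$, $m\in M$. A wall $\mathfrak{d}$ with direction $-n$ is a polyhedral subset of $N_{\mathbb{R}}$ with an attached element $g_{\mathfrak{d}}\in\mathfrak{g}_n^{\parallel}$. Its wall-crossing automorphism is $\exp g_{\mathfrak{d}}=\exp\mathrm{ad}_{g_{\mathfrak{d}}}:R(\!(P)\!)\to R(\!(P)\!)$ ($g_{\mathfrak d}$ acting as a derivation), and the extended wall-crossing automorphism is $\exp\mathrm{ad}_{g_{\mathfrak{d}}}$ acting on all of $\widehat{A}$. For an automorphism $\varphi=\exp\mathrm{ad}_{g_{\mathfrak{d}}}$ of $R(\!(P)\!)$, $\varphi_*$ denotes the induced pushforward (multivector derivative) on polyvector fields: on functions $\varphi_*=\varphi$,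 and a polyvector field $\alpha$ of positive degree being characterized by its action $f\mapsto\alpha(f):=\iota_{df}\alpha$ on functions (a polyvector field of degree one less), $\varphi_*\alpha$ is characterized by $(\varphi_*\alpha)(f)=\varphi_*\big(\alpha(\varphi^{-1}(f))\big)$. In the Gross–Siebert construction, one has a scattering structure consisting of walls $(\mathfrak{d},g_{\mathfrak{d}})$; each chamber corresponds to a copy of $\mathrm{Spec}\,R[\![P]\!]$, and gluing all these schemes together via the wall-crossing automorphisms $\exp\mathrm{ad}_{g_{\mathfrak{d}}}$ yields (a dense open subset of) the mirror space $\mathcal{X}$. Gluing elements of $\widehat A$ via the extended wall-crossing automorphisms means that elements of $\widehat A$ attached to adjacent chambers are related by the extended wall-crossing automorphism of the separating wall.
   Formalization: R is assumed to contain ℚ (be a ℚ-algebra), since exp needs 1/j!; the wall direction n is nonzero, since otherwise exp need not converge; and the powers of the monomial ideal of R[P] meet in 0 (automatic for closed cones), so that the completion and R((P)) make sense. *)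

(* Defs.v *)
From HB Require Import structures.
From mathcomp Require Import all_boot all_order all_algebra.
From mathcomp Require Import all_classical all_reals all_analysis.
From mathcomp Require Import zify.

Set Implicit Arguments.
Unset Strict Implicit.
Unset Printing Implicit Defensive.

Import Order.TTheory GRing.Theory Num.Theory.
Import numFieldNormedType.Exports.

Local Open Scope classical_set_scope.
Local Open Scope ring_scope.

(* A basis of the lattice is fixed: N = Z^r is 'rV[int]_r, N_R is 'rV[K]_r with
   K the real numbers, and M = Hom(N, Z) is 'rV[int]_r in the dual basis. *)

Section Cones.
Variables (K : realType) (r : nat).

Definition strictly_convex_cone (C : set 'rV[K]_r) : Prop :=
  [/\ C 0,
      forall x y, C x -> C y -> C (x + y),
      forall (t : K) x, 0 <= t -> C x -> C (t *: x) &
      forall x, C x -> C (- x) -> x = 0].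

Definition lattice_points (C : set 'rV[K]_r) : set 'rV[int]_r :=
  [set p | C (map_mx intr p)].

Definition polyhedral (D : set 'rV[K]_r) : Prop :=
  exists s : seq ('cV[K]_r * K),
    D = [set x | forall h, h \in s -> (x *m h.1) 0 0 <= h.2].

End Cones.

Section MonomialIdeal.
Variables (r : nat) (P : set 'rV[int]_r).

(* The exponents of the monomials in the k-th power of the monomial maximal
   ideal of R[P]: the elements t + p_1 + ... + p_k with t, p_i in P, p_i <> 0. *)
Fixpoint mpow (k : nat) : set 'rV[int]_r :=
  if k is k'.+1
  then [set p | exists a b, [/\ P a, a <> 0, mpow k' b & p = a + b]]
  else P.

(* R[P] embeds in its completion R[[P]], i.e. the powers of the monomial maximal
   ideal have zero intersection.  The union of the z^n R[[P]] is only meaningful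
   in this case; it is automatic for closed cones, see closed_cone_separated. *)
Definition adically_separated : Prop := \bigcap_k mpow k = set0.

End MonomialIdeal.

Section Separated.
Variables (K : realType) (r : nat).

Lemma cone_norm (C : set 'rV[K]_r) :
  strictly_convex_cone C -> closed C ->
  exists2 e : K, 0 < e &
  forall x y, C x -> C y -> e * `|x| <= `|x + y|.
Proof.
move=> [C0 CD CZ Cp] hcl.
pose S := C `&` [set x : 'rV[K]_r | `|x| = 1].
pose B := C `&` [set x : 'rV[K]_r | `|x| <= 2].
have cS : compact S.
  apply: bounded_closed_compact.
    exists 1; split => // M M1 x [_ /= ->]; exact: ltW.
  apply: closedI => //.
  apply: (@preimage_closed _ _ (Num.norm : 'rV[K]_r -> K) [set x | x = 1]).
    by move=> x _; exact: norm_continuous.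
  exact: closed_eq.
have cB : compact B.
  apply: bounded_closed_compact.
    exists 2; split => // M M1 x [_ /= h]; exact: le_trans h (ltW M1).
  apply: closedI => //.
  apply: (@preimage_closed _ _ (Num.norm : 'rV[K]_r -> K) [set x | x <= 2]).
    by move=> x _; exact: norm_continuous.
  exact: closed_le.
pose f (z : 'rV[K]_r * 'rV[K]_r) := z.1 + z.2.
have cI : closed (f @` (S `*` B)).
  apply: compact_closed; first exact: norm_hausdorff.
  apply: continuous_compact; last exact: compact_setX.
  by apply: continuous_subspaceT => z; exact: add_continuous.
have n0 : (~` (f @` (S `*` B))) 0.
  move=> [[x y] [[/= Cx x1] [Cy _]]] /eqP.
  rewrite /f /= addrC addr_eq0 => /eqP yx.
  have x0 : x = 0 by apply: Cp => //; rewrite -yx.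
  by move: x1; rewrite x0 normr0 => /eqP; rewrite eq_sym oner_eq0.
have [e e0 he] : exists2 e : K, 0 < e & forall z, `|z| < e -> ~ (f @` (S `*` B)) z.
  move/closed_openC: cI; rewrite openE => /(_ 0 n0) /nbhs_ballP[e /= e0 he].
  exists e => // z ze; apply: he; rewrite -ball_normE /= sub0r normrN //.
pose d := Num.min e 1.
have d0 : 0 < d by rewrite lt_min e0 ltr01.
have hd x y : C x -> C y -> `|x| = 1 -> d <= `|x + y|.
  move=> Cx Cy x1; rewrite leNgt; apply/negP; rewrite lt_min => /andP[ze z1].
  apply: (he _ ze); exists (x, y) => //=; split; split => //=.
  have : `|y| <= `|x + y| + `|x| by rewrite -[X in `|X| <= _](addKr x) addrC ler_normB.
  by move/le_trans; apply; rewrite x1 -[2]/(1 + 1) lerD2r ltW.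
exists d => // x y Cx Cy.
have [->|x0] := eqVneq x 0; first by rewrite normr0 mulr0.
have nx : 0 < `|x| by rewrite normr_gt0.
have := hd (`|x|^-1 *: x) (`|x|^-1 *: y).
rewrite -scalerDr !normrZ normfV normr_id mulVf ?gt_eqF //.
move=> /(_ (CZ _ _ _ _) (CZ _ _ _ _) erefl).
by rewrite invr_ge0 normr_ge0 mulrC ler_pdivlMr //; apply.
Qed.

Lemma interval_finite (C : set 'rV[K]_r) (p : 'rV[int]_r) :
  strictly_convex_cone C -> closed C ->
  finite_set [set q | lattice_points C q /\ lattice_points C (p - q)].
Proof.
move=> hC hcl; have [e e0 he] := cone_norm hC hcl.
pose n := Num.bound (`|map_mx intr p : 'rV[K]_r| / e).
pose F := fun M : 'rV['I_(n + n).+1]_r => map_mx (fun k : 'I__ => k%:Z - n%:Z) M.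
apply: (@sub_finite_set _ _ (F @` setT)); last exact/finite_image/finite_finset.
move=> q [Cq Cpq].
have hq : `|map_mx intr q : 'rV[K]_r| < n%:R.
  apply: le_lt_trans (archi_boundP _); last by rewrite divr_ge0 // ltW.
  rewrite ler_pdivlMr // mulrC; have := he _ _ Cq Cpq.
  by rewrite -map_mxD addrC subrK.
have hi (i : 'I_r) : (absz (q (0%R : 'I_1) i) <= n)%N.
  have : `|(q (0%R : 'I_1) i)%:~R : K| <= `|map_mx intr q : 'rV[K]_r|.
    rewrite [leRHS]/Num.norm /= mx_normrE; apply/bigmax_geP; right => /=.
    by exists (0, i) => //=; rewrite mxE.
  by move/le_lt_trans/(_ hq)/ltW; rewrite -intr_norm -[n%:R]/(n%:Z%:~R) ler_int -abszE lez_nat.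
exists (\row_i inord (absz (q (0%R : 'I_1) i + n%:Z))) => //.
apply/rowP => i; rewrite !mxE inordK; have := hi i; lia.
Qed.

Lemma closed_cone_separated (C : set 'rV[K]_r) :
  strictly_convex_cone C -> closed C ->
  adically_separated (lattice_points C).
Proof.
move=> hC hcl; have [C0 CD CZ Cp] := hC.
have PD x y : lattice_points C x -> lattice_points C y -> lattice_points C (x + y).
  by rewrite /lattice_points /= map_mxD; exact: CD.
have key k p : mpow (lattice_points C) k p -> exists s : seq 'rV[int]_r,
  [/\ uniq s, size s = k, lattice_points C p &
      forall q, q \in s -> lattice_points C q /\ lattice_points C (p - q)].
  elim: k p => [|k IH] p /=; first by exists [::].
  move=> [a [b [Pa a0 /IH[s [us <- Pb hs]] ->]]].
  have Pab : lattice_points C (a + b) by exact: PD.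
  exists (a + b :: s); split => //=.
    rewrite us andbT; apply/negP => /hs[_].
    rewrite opprD addrCA subrr addr0 /lattice_points /= map_mxN => Na.
    apply: a0; have := Cp _ Pa Na => /rowP h; apply/rowP => i.
    by have := h i; rewrite !mxE => /eqP; rewrite intr_eq0 => /eqP.
  move=> q; rewrite inE => /orP[/eqP->|/hs[Pq Pbq]].
    by rewrite subrr /lattice_points /= map_mx0.
  by split => //; rewrite -addrA; exact: PD.
apply/seteqP; split => // p /= hp.
have /finite_seqP[t ht] := interval_finite p hC hcl.
have [s [us ss _ hs]] := key _ _ (hp (size t).+1 I).
have : (size s <= size t)%N.
  apply: uniq_leq_size => // q /hs; rewrite -[_ /\ _]/([set q | _ /\ _] q).
  by move=> h; have : [set` t] q by rewrite -ht.
by rewrite ss ltnn.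
Qed.
End Separated.

Section Exterior.
Variables (r : nat) (R : comPzRingType).

(* R (x) Lambda^* M: the value at S = {i_1 < ... < i_d} is the coefficient of
   e_S = e_(i_1) /\ ... /\ e_(i_d), for (e_i) the basis of M.  The product that
   finite functions inherit from R is not the exterior product. *)
Definition ext := {ffun {set 'I_r} -> R^o}.

Definition wedge (x y : ext) : ext :=
  [ffun U : {set 'I_r} => \sum_(S : {set 'I_r} | S \subset U)
     (-1) ^+ #|[pred ij : 'I_r * 'I_r |
                 [&& ij.1 \in S, ij.2 \in U :\: S & (ij.2 < ij.1)%N]]|
     * x S * y (U :\: S)].

(* iota_n (m_1 /\ ... /\ m_d)
   = \sum_k (-1)^(k-1) <n, m_k> m_1 /\ .. m_k omitted .. /\ m_d *)
Definition contract (n : 'rV[int]_r) (x : ext) : ext :=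
  [ffun U : {set 'I_r} => \sum_(i | i \notin U)
     (-1) ^+ #|[pred j in U | (j < i)%N]| * (n 0 i)%:~R * x (i |: U)].

Definition covec (m : 'rV[int]_r) : ext :=
  [ffun U : {set 'I_r} => \sum_(i | U == [set i]%SET) (m 0 i)%:~R].

End Exterior.

Section Polyvector.
Variables (r : nat) (R : comPzRingType).

(* Formal sums \sum_p z^p a_p with a_p in R (x) Lambda^* M; scalar functions
   are the ones of exterior degree 0. *)
Definition pv := 'rV[int]_r -> ext r R.

Implicit Types (a b c f v w : pv) (n p : 'rV[int]_r).

Definition mono n (x : ext r R) : pv := fun p => if p == n then x else 0.

Definition homog (d : nat) : set pv :=
  [set a | forall p (S : {set 'I_r}), a p S != 0 -> #|S| = d].

Definition component (d : nat) a : pv :=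
  fun p => [ffun S : {set 'I_r} => if #|S| == d then a p S else 0].

Definition pvmul a b : pv :=
  fun p => \sum_(q \in [set: 'rV[int]_r]) wedge (a q) (b (p - q)).

Definition l1 a : pv := fun p => contract p (a p).

(* alpha(f) = iota_(df) alpha, with d(z^q) = z^q q for q in N = dual of M. *)
Definition act a f : pv :=
  fun p => \sum_(q \in [set: 'rV[int]_r]) f q finset.set0 *: contract q (a (p - q)).

Variable P : set 'rV[int]_r.

(* z^n mm^k R[[P]] (x) Lambda^* M, with mm^k R[[P]] the kernel of
   R[[P]] = lim_j R[P]/mm^j -> R[P]/mm^k: the series supported in n + mpow P k
   whose reduction modulo each z^n mm^j is a finite sum. *)
Definition pseries n (k : nat) : set pv :=
  [set a | (forall p, a p <> 0 -> mpow P k (p - n)) /\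
           forall j, finite_set [set p | a p <> 0 /\ ~ mpow P j (p - n)]].

Definition Ahat : set pv := \bigcup_n pseries n 0.

Definition laurent : set pv := Ahat `&` homog 0.

Definition adic_cvg (u : nat -> pv) (l : pv) : Prop :=
  Ahat l /\ exists n, forall k, exists J, forall j, (J <= j)%N ->
    pseries n k (l - u j).

Definition adic_lim (u : nat -> pv) : pv := xget 0 [set l | adic_cvg u l].

(* Q-algebra structure of R: needed for the coefficients 1/j! of exp *)
Variable iota : {rmorphism rat -> R}.

Definition exp_op (D : pv -> pv) a : pv :=
  adic_lim (fun J => \sum_(j < J) iota (j`!%:R^-1) *: iter j D a).

(* The Schouten-Nijenhuis bracket.  Signs are in terms of |a| = d - 1 for a of
   exterior degree d, and d + 1 has the parity of d - 1. *)
Record schouten_nijenhuis (br : pv -> pv -> pv) : Prop := SchoutenNijenhuis {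
  sn_closed : forall a b, Ahat a -> Ahat b -> Ahat (br a b);
  sn_linl : forall (s : R) a a' b, Ahat a -> Ahat a' -> Ahat b ->
    br (s *: a + a') b = s *: br a b + br a' b;
  sn_linr : forall (s : R) a b b', Ahat a -> Ahat b -> Ahat b' ->
    br a (s *: b + b') = s *: br a b + br a b';
  sn_degree : forall d e a b, Ahat a -> Ahat b -> homog d a -> homog e b ->
    forall p (S : {set 'I_r}), br a b p S != 0 -> (#|S|.+1 = d + e)%N;
  sn_antisym : forall d e a b, Ahat a -> Ahat b -> homog d a -> homog e b ->
    br a b = - ((-1) ^+ (d.+1 * e.+1) *: br b a);
  sn_jacobi : forall d e a b c, Ahat a -> Ahat b -> Ahat c ->
    homog d a -> homog e b ->
    br a (br b c) = br (br a b) c + (-1) ^+ (d.+1 * e.+1) *: br b (br a c);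
  sn_leibniz : forall d e a b c, Ahat a -> Ahat b -> Ahat c ->
    homog d a -> homog e b ->
    br a (pvmul b c) = pvmul (br a b) c + (-1) ^+ (d.+1 * e) *: pvmul b (br a c);
  sn_fun : forall v f, Ahat v -> homog 1 v -> laurent f -> br v f = act v f;
  sn_vect : forall v w f, Ahat v -> homog 1 v -> Ahat w -> homog 1 w ->
    laurent f -> act (br v w) f = act v (act w f) - act w (act v f) }.

Definition phi_inv (phi : pv -> pv) : pv -> pv := 'pinv_(fun=> 0) laurent phi.

(* phi_* = phi on functions and (phi_* a)(f) = phi_* (a (phi^-1 f)) for a of
   positive degree; pushforward extends this to mixed degrees. *)
Fixpoint is_pushforward_deg (phi : pv -> pv) (d : nat) a b : Prop :=
  if d is d'.+1
  then forall f, laurent f ->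
         is_pushforward_deg phi d' (act a (phi_inv phi f)) (act b f)
  else b = phi a.

Definition is_pushforward (phi : pv -> pv) a b : Prop :=
  Ahat b /\
  forall d, is_pushforward_deg phi d (component d a) (component d b).

Definition pushforward (phi : pv -> pv) a : pv :=
  xget 0 [set b | is_pushforward phi a b].

Definition g_alg : set pv := [set h | [/\ Ahat h, homog 1 h & l1 h = 0]].

Definition Rspan (X : set pv) : set pv :=
  [set h | exists (k : nat) (s : 'I_k -> R) (x : 'I_k -> pv),
     (forall i, X (x i)) /\ h = \sum_(i < k) s i *: x i].

Definition g_par n : set pv :=
  [set h | g_alg h /\ exists u : nat -> pv, adic_cvg u h /\
     forall j, Rspan [set x | g_alg x /\ exists (k : nat) (m : 'rV[int]_r),
                        (0 < k)%N /\ x = mono (n *+ k) (covec R m)] (u j)].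

Variable K : realType.

Record wall := Wall {
  wall_support : set 'rV[K]_r;
  wall_dir : 'rV[int]_r; (* the direction of the wall is - wall_dir *)
  wall_elt : pv }.

(* exp does not converge for n = 0, so a direction is nonzero *)
Definition is_wall (d : wall) : Prop :=
  [/\ polyhedral (wall_support d), P (wall_dir d), wall_dir d <> 0 &
      g_par (wall_dir d) (wall_elt d)].

(* exp g_d on R((P)), with g_d acting as a derivation *)
Definition wall_crossing (d : wall) : pv -> pv := exp_op (act (wall_elt d)).

Definition ext_wall_crossing (br : pv -> pv -> pv) (d : wall) : pv -> pv :=
  exp_op (br (wall_elt d)).

(* crossing s d s': the chambers s and s' are adjacent and separated by the wall
   d, whose wall-crossing automorphism is the one for passing from s to s'. *)
Record scattering := Scattering {
  chamber : Type;
  crossing : chamber -> wall -> chamber -> Prop;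
  crossing_wall : forall s d s', crossing s d s' -> is_wall d }.

Definition glued (br : pv -> pv -> pv) (D : scattering)
    (a : chamber D -> pv) : Prop :=
  (forall s, Ahat (a s)) /\
  forall s d s', crossing s d s' -> a s' = ext_wall_crossing br d (a s).

(* The mirror is glued from one copy of Spec R[[P]] for each chamber.  The
   identifications of charts are generated by the wall-crossing automorphisms. *)
Inductive gluing_iso (D : scattering) :
    chamber D -> chamber D -> (pv -> pv) -> Prop :=
| gluing_id s : gluing_iso s s id
| gluing_cross s d s' : crossing s d s' -> gluing_iso s s' (wall_crossing d)
| gluing_inv s s' phi : gluing_iso s s' phi -> gluing_iso s' s (phi_inv phi)
| gluing_comp s s' s'' phi psi : gluing_iso s s' phi -> gluing_iso s' s'' psi ->
    gluing_iso s s'' (psi \o phi).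

(* Sections of a sheaf glued from charts are families of local sections that
   the gluing isomorphisms carry to each other; on the chart Spec R[[P]] the
   meromorphic (i.e. Laurent) polyvector fields are the elements of Ahat. *)
Definition meromorphic_section (D : scattering) (a : chamber D -> pv) : Prop :=
  (forall s, Ahat (a s)) /\
  forall s s' phi, gluing_iso s s' phi -> is_pushforward phi (a s) (a s').

End Polyvector.

(* Main.v *)
(* Write D = [g, -] and E = exp D.  For a function f and a polyvector field a the
   Leibniz rule gives [f, a] = - a(f), so the Jacobi identity becomes
   D(a(f)) = (D a)(f) + a(D f).  Exponentiating, E(a(f)) = (E a)(E f), and replacing
   f by E^-1 f shows that E a has the property that characterizes the pushforward.
   Since a polyvector field of positive degree is determined by its action on the
   functions z^(e_i), this property determines E a uniquely; the same remark,
   with the displayed identity, shows by induction on the degree that D raises the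
   order of vanishing, which is what makes E converge, although the bracket is not
   assumed to be continuous. *)

From HB Require Import structures.
From mathcomp Require Import all_boot all_order all_algebra.
From mathcomp Require Import all_classical all_reals finmap ring.
Require Import Defs.

Set Implicit Arguments.
Unset Strict Implicit.
Unset Printing Implicit Defensive.

Import Order.TTheory GRing.Theory Num.Theory.

Local Open Scope classical_set_scope.
Local Open Scope ring_scope.

(** The axioms for [br] only give linearity for finite sums, so E cannot be expanded termwise inside
    a bracket. Identities between exponentials are therefore proved for partial sums, up to an error
    in z^n mm^J; since this holds for every J, separatedness removes the error. The offset n must
    stay fixed in such a comparison, hence the insistence on operators that preserve each z^n
    R[[P]]. The inverse of E is exp (- D), and it comes from the same Cauchy product as the identity
    for the action on functions. For the gluing statement, transition maps also include inverses and
    composites of wall crossings. What is carried along a chain of chambers is thus an extension of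
    the transition map to an automorphism of [Ahat] compatible with exterior degree and with the
    action on functions, a notion stable under these operations. *)

Lemma fsum_finite (T : choiceType) (V : nmodType) (A : set T) (F : T -> V) :
  finite_set A -> (forall q, ~ A q -> F q = 0) ->
  \sum_(q \in [set: T]) F q = \sum_(q <- fset_set A) F q.
Proof.
move=> fA F0; rewrite -(fsbig_widen A setT) ?fsbig_finite // => q [_]; exact: F0.
Qed.

Lemma fsum_single (T : choiceType) (V : nmodType) (t : T) (F : T -> V) :
  (forall q, q <> t -> F q = 0) -> \sum_(q \in [set: T]) F q = F t.
Proof.
move=> F0; rewrite (fsum_finite (finite_set1 t)) // fset_set1.
by rewrite big_seq_fset1.
Qed.

(** This serves the Cauchy product of two truncated series. The triangle i + j < J, read along
    antidiagonals, will carry the binomial expansion; the remaining terms will be negligible because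
    their order is at least J. *)
Lemma sum_square_triangle (V : zmodType) (J : nat) (F : nat -> nat -> V) :
  \sum_(i < J) \sum_(j < J) F i j
  = \sum_(N < J) \sum_(i < N.+1) F i (N - i)%N
    + \sum_(i < J) \sum_(j < J | (J <= i + j)%N) F i j.
Proof.
have -> : \sum_(N < J) \sum_(i < N.+1) F i (N - i)%N
        = \sum_(i < J) \sum_(j < J | (i + j < J)%N) F i j.
  transitivity (\sum_(0 <= N < J) \sum_(0 <= i < J | (i <= N)%N) F i (N - i)%N).
    rewrite big_mkord; apply: eq_bigr => N _.
    rewrite -(big_mkord xpredT (fun i => F i (N - i)%N)) (big_nat_widen _ _ J) //.
  rewrite (exchange_big_dep_nat xpredT) /= ?big_mkord //; apply: eq_bigr => i _.
  rewrite -(big_mkord (fun j => i + j < J)%N (F i)).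
  rewrite (big_cat_nat (n := i)) ?(ltnW (ltn_ord i)) //=.
  rewrite big_nat_cond big1 ?add0r; last first.
    by move=> N /andP[/andP[_ h1] h2]; rewrite ltnNge h2 in h1.
  rewrite -{1}[X in \sum_(X <= _ < _ | _) _]add0n big_addn.
  rewrite (big_nat_widen _ _ J) ?leq_subr //; apply: eq_big => N.
    by rewrite leq_addl /= ltn_subRL.
  by rewrite addnK.
under eq_bigr => i _ do rewrite (bigID (fun j : 'I_J => i + j < J)%N) /=.
rewrite big_split; congr (_ + _); apply: eq_bigr => i _.
by apply: eq_bigl => j; rewrite -leqNgt.
Qed.

(** * Exterior algebra: signs in contraction and exterior product *)

Section ExteriorAlgebra.
Variables (r : nat) (R : comPzRingType).
Implicit Types (x y : ext r R) (n : 'rV[int]_r) (S U : {set 'I_r}).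

(** Exponent of the sign for moving e_i from the front to its place in the ordered product over
    U. *)
Definition inv_count U (i : 'I_r) : nat := #|[pred j in U | (j < i)%N]|.
Definition basis_vec (i : 'I_r) : 'rV[int]_r := delta_mx 0 i.

Lemma contract_is_linear n (s : R) x y :
  contract n (s *: x + y) = s *: contract n x + contract n y.
Proof.
apply/ffunP => U; rewrite !ffunE scaler_sumr -big_split /=.
by apply: eq_bigr => i _; rewrite !ffunE mulrDr [in RHS]/GRing.scale /= mulrCA.
Qed.

Lemma wedge_is_linear x (s : R) y z :
  wedge x (s *: y + z) = s *: wedge x y + wedge x z.
Proof.
apply/ffunP => U; rewrite !ffunE scaler_sumr -big_split /=.
by apply: eq_bigr => i _; rewrite !ffunE mulrDr [in RHS]/GRing.scale /= mulrCA.
Qed.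

HB.instance Definition _ n :=
  GRing.isLinear.Build R (ext r R) (ext r R) _ (@contract r R n)
    (@contract_is_linear n).
HB.instance Definition _ x :=
  GRing.isLinear.Build R (ext r R) (ext r R) _ (@wedge r R x)
    (@wedge_is_linear x).

Lemma wedge0l y : wedge (0 : ext r R) y = 0.
Proof.
by apply/ffunP => U; rewrite !ffunE big1 // => S _; rewrite !ffunE mulr0 mul0r.
Qed.

Lemma contract_basis i x U :
  contract (basis_vec i) x U
  = if i \in U then 0 else (-1) ^+ inv_count U i * x (i |: U).
Proof.
rewrite ffunE; case: ifP => iU.
  rewrite big1 // => j jU; rewrite mxE eqxx /=; case: eqP => [ji|_]; last first.
    by rewrite /= mulr0 mul0r.
  by rewrite ji iU in jU.
rewrite (bigD1 i) ?iU //= big1 ?addr0.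
  by rewrite mxE !eqxx mulr1.
by move=> j /andP[_ /negbTE ji]; rewrite mxE eqxx ji /= mulr0 mul0r.
Qed.

Lemma wedge_covec i x U :
  wedge (covec R (basis_vec i)) x U
  = if i \in U then (-1) ^+ inv_count (U :\ i) i * x (U :\ i) else 0.
Proof.
have cE S : covec R (basis_vec i) S = (S == [set i]%SET)%:R.
  rewrite ffunE; case: eqP => [->|/eqP Si].
    rewrite (bigD1 i) //= mxE !eqxx big1 ?addr0 // => j /andP[_ /negbTE ji].
    by rewrite mxE ji andbF.
  rewrite big1 // => j /eqP Sj; rewrite mxE eqxx /=; case: eqP => // ji.
  by rewrite Sj ji eqxx in Si.
rewrite ffunE; case: ifP => iU.
  rewrite (bigD1 [set i]%SET) /=; last by rewrite finset.sub1set.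
  rewrite big1 ?addr0.
    rewrite cE eqxx mulr1; congr (_ ^+ _ * _).
    rewrite /inv_count -(card_in_image (f := fun j => (i, j))
      (A := [pred j in U :\ i | (j < i)%N])).
      apply: eq_card => -[s t]; apply/idP/fintype.imageP => /=.
        rewrite !inE /= => /and3P[/eqP-> h1 h2]; exists t => //.
        by rewrite !inE h1 h2.
      by move=> [j]; rewrite !inE /= => /andP[h1 h2] [-> ->]; rewrite eqxx h1.
    by move=> j1 j2 _ _ [].
  by move=> S /andP[_ /negbTE h]; rewrite cE h mulr0 mul0r.
rewrite big1 // => S SU; rewrite cE; case: eqP => [Si|_]; last by rewrite mulr0 mul0r.
by move: SU; rewrite Si finset.sub1set iU.
Qed.

Lemma inv_countD1 U i k : i \in U ->
  inv_count U k = ((i < k)%N + inv_count (U :\ i) k)%N.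
Proof.
move=> iU; rewrite /inv_count (cardD1 i) !inE iU /=; congr (_ + _)%N.
by apply: eq_card => j; rewrite !inE; case: (j == i).
Qed.

(** Contraction is an antiderivation, checked on the coefficient of each U. If i is not in U, only
    the index i contributes. If i is in U, the index i in the last term cancels n_i x, and the
    indices k outside U match with opposite signs because exactly one of k < i and i < k holds. *)
Lemma contract_wedge_covec n i x :
  contract n (wedge (covec R (basis_vec i)) x)
  = (n 0 i)%:~R *: x - wedge (covec R (basis_vec i)) (contract n x).
Proof.
apply/ffunP => U.
have -> (a b : ext r R) : (a - b) U = a U - b U by rewrite !ffunE.
rewrite wedge_covec !ffunE; case: ifP => iU; last first.
  rewrite subr0 (bigD1 i) ?iU //= big1 ?addr0.
    by rewrite wedge_covec finset.setU11 finset.setU1K ?iU //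
      mulrACA /inv_count -signr_odd -expr2 sqrr_sign mul1r.
  move=> k /andP[_ ki]; rewrite wedge_covec !inE iU orbF eq_sym (negbTE ki) mulr0 //.
rewrite [X in _ = _ - _ * X](bigD1 i) ?inE ?eqxx //= mulrDr opprD addrA finset.setD1K //.
rewrite [in X in _ = _ + _ + X]mulr_sumr.
have -> : (n 0 i)%:~R *: x U - (-1) ^+ inv_count (U :\ i) i *
    ((-1) ^+ #|[pred j in U :\ i | (j < i)%N]| * (n 0 i)%:~R * x U) = 0.
  rewrite -/(inv_count _ _) !mulrA -signr_odd -expr2 sqrr_sign mul1r.
  exact: subrr.
rewrite add0r -sumrN; apply: eq_big => k.
  by rewrite !inE negb_and negbK; case: eqVneq => [->|_]; rewrite ?iU /= ?andbT.
move=> kU; have ki : k != i by apply: contraNneq kU => ->.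
rewrite -!/(inv_count _ _) wedge_covec !inE iU orbT.
have -> : (k |: U) :\ i = k |: (U :\ i).
  by apply/setP => j; rewrite !inE; case: eqVneq => //= ->; rewrite eq_sym (negbTE ki).
have -> : inv_count (k |: (U :\ i)) i = ((k < i)%N + inv_count (U :\ i) i)%N.
  by rewrite (inv_countD1 _ (i := k)) ?finset.setU11 // finset.setU1K //
    !inE (negbTE kU) andbF.
rewrite (inv_countD1 k iU) !exprD.
have -> : (-1) ^+ (k < i)%N = - (-1) ^+ (i < k)%N :> R.
  by move: ki; rewrite neq_ltn => /orP[] h;
    rewrite h (ltnNge _ _) (ltnW h) /= expr0 expr1 ?opprK.
rewrite !mulNr !mulrN; congr (- _).
set s := _ ^+ (i < k)%N; have ss : s * s = 1 by rewrite -expr2 sqrr_sign.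
set a := _ ^+ _; set b := _ ^+ _; set c := _%:~R; set d := x _.
transitivity ((s * s) * (b * (a * c * d))); last by rewrite ss mul1r.
by ring.
Qed.

(** Unit of the exterior product: e_S for S empty. *)
Definition ext_one : ext r R := [ffun S => (S == finset.set0)%:R].

Lemma ext_oneE S : ext_one S = (S == finset.set0)%:R.
Proof. by rewrite ffunE. Qed.

Lemma ext_oneU1 i S : ext_one (i |: S) = 0.
Proof. by rewrite ext_oneE; case: eqP => // /setP/(_ i); rewrite !inE eqxx. Qed.

Lemma contract_one n : contract n ext_one = 0.
Proof.
by apply/ffunP => S; rewrite !ffunE big1 // => j _; rewrite ext_oneU1 mulr0.
Qed.

Lemma contract_covec n i :
  contract n (covec R (basis_vec i)) = (n 0 i)%:~R *: ext_one.
Proof.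
(* Writing e_i as e_i /\ 1 makes the antiderivation rule applicable. *)
have -> : covec R (basis_vec i) = wedge (covec R (basis_vec i)) ext_one.
  apply/ffunP => S; rewrite wedge_covec [LHS]ffunE; case: ifP => iS; last first.
    rewrite big1 // => j /eqP Sj; rewrite mxE eqxx /=; case: eqP => // ji.
    by rewrite Sj ji !inE eqxx in iS.
  rewrite ext_oneE; case: eqP => [Si|Si]; last first.
    rewrite mulr0 big1 // => j /eqP Sj; case: Si; apply/setP => k.
    rewrite Sj !inE; case: eqVneq => //= ki; move: iS; rewrite Sj inE => /eqP ij.
    by rewrite -ij (negbTE ki).
  have -> : S = [set i]%SET by rewrite -(finset.setD1K iS) Si finset.setU0.
  rewrite (bigD1 i) //= big1 => [|j /andP[/eqP/finset.set1_inj -> ]];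
    last by rewrite eqxx.
  rewrite mxE !eqxx addr0 /inv_count finset.setDv eq_card0 ?mulr1 // => j.
  by rewrite !inE.
by rewrite contract_wedge_covec contract_one linear0 subr0.
Qed.

Lemma wedge_scalarl (s : R) x : wedge (s *: ext_one) x = s *: x.
Proof.
apply/ffunP => U; rewrite !ffunE (bigD1 finset.set0) ?finset.sub0set //= big1 ?addr0.
  rewrite !ffunE eqxx finset.setD0 eq_card0 ?expr0 ?mul1r => [|ij]; last by rewrite !inE.
  congr (_ * _); exact: mulr1.
by move=> S /andP[_ /negbTE S0]; rewrite !ffunE S0 scaler0 mulr0 mul0r.
Qed.

End ExteriorAlgebra.

(** * The adic filtration, limits, and convergence of the action on functions *)

Section Filtration.
Variables (r : nat) (R : comPzRingType) (P : set 'rV[int]_r).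
Hypothesis P0 : P 0.
Hypothesis PD : forall x y, P x -> P y -> P (x + y).
Hypothesis P_separated : adically_separated P.
Implicit Types (a b f : pv r R) (n m p q : 'rV[int]_r).

Lemma mpow_ideal k p q : P p -> mpow P k q -> mpow P k (p + q).
Proof.
elim: k q => [|k IH] q Pp /=; first exact: PD.
move=> [x [y [Px x0 hy ->]]]; exists x, (p + y); split=> //; first exact: IH.
by rewrite addrCA.
Qed.

Lemma mpow_add j k p q : mpow P j p -> mpow P k q -> mpow P (j + k) (p + q).
Proof.
elim: j p => [|j IH] p /=; first exact: mpow_ideal.
move=> [x [y [Px x0 hy ->]]] hq; exists x, (y + q); split=> //; first exact: IH.
by rewrite addrA.
Qed.

Lemma mpowW j k p : (j <= k)%N -> mpow P k p -> mpow P j p.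
Proof.
move=> /subnK <-; elim: (k - j)%N p => [|i IH] p //= [x [y [Px _ hy ->]]].
exact/mpow_ideal/IH.
Qed.

Lemma mpow_separated p : exists k, ~ mpow P k p.
Proof.
apply/existsNP => h; have : (\bigcap_k mpow P k) p by move=> k _; exact: h.
by rewrite P_separated.
Qed.

Lemma pseriesW n j k a : (j <= k)%N -> pseries P n k a -> pseries P n j a.
Proof. by move=> jk [h1 h2]; split=> // p /h1; exact: mpowW. Qed.

Lemma pseries_sub n k a b :
  (forall p, a p = 0 -> b p = 0) -> pseries P n k a -> pseries P n k b.
Proof.
move=> ab [h1 h2]; split=> [p bp|j]; first by apply: h1 => /ab.
by apply: sub_finite_set (h2 j) => p [bp hp]; split=> // /ab.
Qed.

Lemma pseriesP n k (s : R) a b : pseries P n k a -> pseries P n k b ->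
  pseries P n k (s *: a + b).
Proof.
move=> [a1 a2] [b1 b2].
have ab p : (s *: a + b) p <> 0 -> a p <> 0 \/ b p <> 0.
  move=> h; apply/not_andP => -[ap bp]; apply: h.
  by rewrite !fctE ap bp scaler0 addr0.
split=> [p /ab[/a1|/b1]//|j].
apply: (@sub_finite_set _ _ ([set p | a p <> 0 /\ ~ mpow P j (p - n)]
    `|` [set p | b p <> 0 /\ ~ mpow P j (p - n)])).
  by move=> p [/ab[h|h] hp]; [left|right].
by rewrite finite_setU.
Qed.

Lemma pseries0 n k : pseries P n k (0 : pv r R).
Proof.
split=> [p /(_ erefl)//|j]; apply: (@sub_finite_set _ _ set0) => //.
by move=> p [/(_ erefl)].
Qed.

Lemma pseriesZ n k (s : R) a : pseries P n k a -> pseries P n k (s *: a).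
Proof. by move=> ha; rewrite -[_ *: _]addr0; apply: pseriesP => //; exact: pseries0. Qed.

Lemma pseriesD n k a b :
  pseries P n k a -> pseries P n k b -> pseries P n k (a + b).
Proof. by move=> ha hb; rewrite -[a]scale1r; exact: pseriesP. Qed.

Lemma pseriesN n k a : pseries P n k a -> pseries P n k (- a).
Proof. by rewrite -scaleN1r; exact: pseriesZ. Qed.

Lemma pseriesB n k a b :
  pseries P n k a -> pseries P n k b -> pseries P n k (a - b).
Proof. by move=> ha /pseriesN; exact: pseriesD. Qed.

Lemma pseries_sum n k (I : Type) (s : seq I) (Q : pred I) (a : I -> pv r R) :
  (forall i, Q i -> pseries P n k (a i)) ->
  pseries P n k (\sum_(i <- s | Q i) a i).
Proof. move=> h; apply: big_ind => //; [exact: pseries0|exact: pseriesD]. Qed.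

Lemma pseries_Ahat n k a : pseries P n k a -> Ahat P a.
Proof. by move=> /(pseriesW (leq0n k)) ha; exists n. Qed.

Lemma pseries_mono n (x : ext r R) : pseries P n 0 (mono n x).
Proof.
have hm p : mono n x p <> 0 -> p = n by rewrite /mono; case: eqP.
split=> [p /hm -> /=|j]; first by rewrite subrr.
by apply: sub_finite_set (finite_set1 n) => p [/hm].
Qed.

Lemma pseries_eq n a b : (forall k, pseries P n k (a - b)) -> a = b.
Proof.
move=> h; apply/eqP; rewrite -subr_eq0; apply/eqP/funext => p.
have [k hk] := mpow_separated (p - n).
by apply: contrapT => hp; apply/hk/(h k).1.
Qed.

(** The coefficient at p is constant from the partial sum of length [N p] on, where [N p] is a power
    of the monomial ideal that excludes p - n. The limit reads each coefficient off that partial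
    sum. *)
Lemma pseries_series n (x : nat -> pv r R) :
  (forall j, pseries P n j (x j)) ->
  exists l, forall J, pseries P n J (l - \sum_(j < J) x j).
Proof.
move=> hx.
have [N hN] := boolp.choice (fun p => mpow_separated (p - n)).
pose S J : pv r R := \sum_(j < J) x j.
have SE J J' p : ~ mpow P J (p - n) -> (J <= J')%N -> S J' p = S J p.
  move=> hJ /subnK <-; elim: (J' - J)%N => // i; rewrite /S big_ord_recr /= fctE => ->.
  rewrite [X in _ + X](_ : _ = 0) ?addr0 //; apply: contrapT => /(hx _).1 h.
  by apply: hJ; apply: mpowW h; rewrite leq_addl.
exists (fun p => S (N p) p) => J.
have lE J' p : ~ mpow P J' (p - n) -> S (N p) p = S J' p.
  move=> hJ'; rewrite -(SE (N p) (maxn (N p) J')) ?leq_maxl //.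
  by rewrite (SE J') ?leq_maxr.
have S0 J' : pseries P n 0 (S J').
  by apply: pseries_sum => i _; exact: pseriesW (hx i).
split=> [p hp|j].
  by apply: contrapT => hJ; apply: hp; rewrite !fctE (lE J) // subrr.
apply: sub_finite_set ((pseriesB (S0 j) (S0 J)).2 j) => p [hp hj]; split=> //.
by move: hp; rewrite !fctE (lE j).
Qed.

(** The two limits may come with different offsets, so the comparison is made coefficient by
    coefficient: far enough in the sequence, both agree with [u] at p. *)
Lemma adic_cvg_unique u (l l' : pv r R) :
  adic_cvg P u l -> adic_cvg P u l' -> l = l'.
Proof.
move=> [_ [n hn]] [_ [n' hn']]; apply: funext => p.
have [k hk] := mpow_separated (p - n).
have [k' hk'] := mpow_separated (p - n').
have [J hJ] := hn k; have [J' hJ'] := hn' k'.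
have /(_ (leq_maxl _ _))[h _] := hJ (maxn J J').
have /(_ (leq_maxr _ _))[h' _] := hJ' (maxn J J').
transitivity (u (maxn J J') p); apply/eqP; rewrite -subr_eq0.
  by apply/eqP; apply: contrapT => /h.
by rewrite -oppr_eq0 opprB; apply/eqP; apply: contrapT => /h'.
Qed.

Lemma adic_limE n u (l : pv r R) : Ahat P l ->
  (forall J, pseries P n J (l - u J)) -> adic_lim P u = l.
Proof.
move=> hl hu; apply: xget_unique => [|l' hl'].
  split=> //; exists n => k; exists k => j kj; exact: pseriesW (hu j).
apply: adic_cvg_unique hl' _; split=> //.
by exists n => k; exists k => j kj; exact: pseriesW (hu j).
Qed.

(** Choose i with p - (m + n) outside the i-th power. Since p - (m + n) = (q - m) + (p - q - n), no
    contributing q has q - m in that power, and f has only finitely many other exponents. *)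
Lemma conv_finite n m k j a f p : pseries P n k a -> pseries P m j f ->
  finite_set [set q | f q <> 0 /\ a (p - q) <> 0].
Proof.
move=> [a1 _] [f1 f2]; have [i hi] := mpow_separated (p - (m + n)).
apply: sub_finite_set (f2 i) => q [fq /a1 aq]; split=> // hq; apply: hi.
have -> : p - (m + n) = (q - m) + (p - q - n).
  by rewrite addrACA [q + _]addrC subrK opprD.
by apply: mpowW (mpow_add hq aq); rewrite leq_addr.
Qed.

(** The list [s] does not depend on the summand or on its values, so all the sums in one identity
    become finite sums over the same indices. *)
Lemma conv_sum n m k j a f p : pseries P n k a -> pseries P m j f ->
  exists s : seq 'rV[int]_r, forall (V : nmodType) (F : 'rV[int]_r -> V),
    (forall q, f q = 0 \/ a (p - q) = 0 -> F q = 0) ->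
    \sum_(q \in [set: 'rV[int]_r]) F q = \sum_(q <- s) F q.
Proof.
move=> ha hf; have fin := conv_finite p ha hf.
exists (fset_set [set q | f q <> 0 /\ a (p - q) <> 0]) => V F F0.
apply: fsum_finite => // q /not_andP h; apply: F0.
by case: h => /contrapT ->; [left|right].
Qed.

Lemma act_supp a f p : act a f p <> 0 -> exists q, f q <> 0 /\ a (p - q) <> 0.
Proof.
move=> h; apply: contrapT => /forallNP h'; apply: h; apply: fsbig1 => q _.
have /not_andP[] := h' q => /contrapT ->; first by rewrite ffunE scale0r.
by rewrite linear0 scaler0.
Qed.

Lemma pseries_act n m k j a f : pseries P n k a -> pseries P m j f ->
  pseries P (m + n) (j + k) (act a f).
Proof.
move=> [a1 a2] [f1 f2].
have E p q : p - (m + n) = (q - m) + (p - q - n).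
  by rewrite addrACA [q + _]addrC subrK opprD.
split=> [p /act_supp[q [/f1 fq /a1 aq]]|i]; first by rewrite (E p q); exact: mpow_add.
(* If p - (m + n) lies outside the i-th power, so do both q - m and p - q - n; hence p is a sum of
   elements of two finite sets. *)
have := finite_image2 +%R (f2 i) (a2 i); apply: sub_finite_set.
move=> p [/act_supp[q [fq aq]] hp]; exists q; last exists (p - q).
- split=> // hq; apply: hp; rewrite (E p q).
  by apply: mpowW (mpow_add hq (a1 _ aq)); rewrite leq_addr.
- split=> // hq; apply: hp; rewrite (E p q).
  by apply: mpowW (mpow_add (f1 _ fq) hq); rewrite leq_addl.
- by rewrite addrC subrK.
Qed.

(* Ahat is not closed under addition when P does not span the lattice, so
   linearity only makes sense on each z^n R[[P]] separately. *)
Definition linear_on n (T : pv r R -> pv r R) :=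
  forall (s : R) a b, pseries P n 0 a -> pseries P n 0 b ->
    T (s *: a + b) = s *: T a + T b.

Lemma linear_on0 n T : linear_on n T -> T 0 = 0.
Proof.
move=> hT; have := hT 1 0 0 (pseries0 _ _) (pseries0 _ _).
by rewrite !scale1r addr0 => /(congr1 (fun x => x - T 0)); rewrite subrr addrK.
Qed.

Lemma linear_onZ n T : linear_on n T -> forall s a, pseries P n 0 a ->
  T (s *: a) = s *: T a.
Proof.
move=> hT s a ha; have := hT s a 0 ha (pseries0 _ _).
by rewrite !addr0 (linear_on0 hT) addr0.
Qed.

Lemma linear_onB n T : linear_on n T -> forall a b, pseries P n 0 a ->
  pseries P n 0 b -> T (a - b) = T a - T b.
Proof.
by move=> hT a b ha hb; rewrite addrC -scaleN1r hT // scaleN1r addrC.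
Qed.

Lemma linear_on_sum n T : linear_on n T ->
  forall (I : Type) (s : seq I) (Q : pred I) (c : I -> R) (a : I -> pv r R),
  (forall i, Q i -> pseries P n 0 (a i)) ->
  T (\sum_(i <- s | Q i) c i *: a i) = \sum_(i <- s | Q i) c i *: T (a i).
Proof.
move=> hT I s Q c a ha; elim: s => [|i s IH]; first by rewrite !big_nil (linear_on0 hT).
rewrite !big_cons; case: ifP => // Qi.
rewrite hT ?IH //; first exact: ha.
by apply: pseries_sum => j Qj; exact/pseriesZ/ha.
Qed.

Lemma act_linearl n m f : pseries P m 0 f -> linear_on n (fun a => act a f).
Proof.
move=> hf s a b ha hb; apply: funext => p; rewrite !fctE.
pose A (c : pv r R) := [set q | f q <> 0 /\ c (p - q) <> 0].
have fA := conv_finite p ha hf; have fB := conv_finite p hb hf.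
have fAB : finite_set (A a `|` A b) by rewrite finite_setU.
have F0 (c : pv r R) q : ~ A c q -> f q finset.set0 *: contract q (c (p - q)) = 0.
  by move=> /not_andP[] /contrapT ->; rewrite ?ffunE ?scale0r // linear0 scaler0.
have lin q : f q finset.set0 *: contract q ((s *: a + b) (p - q))
   = s *: (f q finset.set0 *: contract q (a (p - q)))
     + f q finset.set0 *: contract q (b (p - q)).
  by rewrite !fctE linearP scalerDr !scalerA mulrC.
rewrite /act !(fsum_finite fAB).
- by rewrite scaler_sumr -big_split; apply: eq_bigr => q _; exact: lin.
- by move=> q hq; apply: F0 => h; apply: hq; right.
- by move=> q hq; apply: F0 => h; apply: hq; left.
- move=> q /not_orP[h1 h2]; rewrite lin F0 // F0 // scaler0 addr0 //.
Qed.

Lemma act_linearr n m a : pseries P m 0 a -> linear_on n (act a).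
Proof.
move=> ha s f g hf hg; apply: funext => p; rewrite !fctE.
pose A (h : pv r R) := [set q | h q <> 0 /\ a (p - q) <> 0].
have fA := conv_finite p ha hf; have fB := conv_finite p ha hg.
have fAB : finite_set (A f `|` A g) by rewrite finite_setU.
have F0 (h : pv r R) q : ~ A h q -> h q finset.set0 *: contract q (a (p - q)) = 0.
  by move=> /not_andP[] /contrapT ->; rewrite ?ffunE ?scale0r // linear0 scaler0.
have lin q : (s *: f + g) q finset.set0 *: contract q (a (p - q))
   = s *: (f q finset.set0 *: contract q (a (p - q)))
     + g q finset.set0 *: contract q (a (p - q)).
  by rewrite !fctE !ffunE scalerDl scalerA.
rewrite /act !(fsum_finite fAB).
- by rewrite scaler_sumr -big_split; apply: eq_bigr => q _; exact: lin.
- by move=> q hq; apply: F0 => h; apply: hq; right.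
- by move=> q hq; apply: F0 => h; apply: hq; left.
- move=> q /not_orP[h1 h2]; rewrite lin F0 // F0 // scaler0 addr0 //.
Qed.

End Filtration.

(** * Exterior degree, and detection of polyvector fields by monomials *)

Section Degree.
Variables (r : nat) (R : comPzRingType) (P : set 'rV[int]_r).
Hypothesis P0 : P 0.
Implicit Types (a b f : pv r R) (n m p q : 'rV[int]_r).

(** A general predicate covers both the components by degree and the splitting into multiples of
    single e_S. *)
Definition restrict (Q : pred {set 'I_r}) a : pv r R :=
  fun p => [ffun S : {set 'I_r} => if Q S then a p S else 0].

Lemma componentE d a : component d a = restrict (fun S => #|S| == d) a.
Proof. by []. Qed.

Lemma restrict_is_linear Q (s : R) a b :
  restrict Q (s *: a + b) = s *: restrict Q a + restrict Q b.
Proof.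
apply/funext => p; apply/ffunP => S; rewrite !fctE !ffunE.
by case: ifP => //; rewrite scaler0 addr0.
Qed.

HB.instance Definition _ Q :=
  GRing.isLinear.Build R (pv r R) (pv r R) _ (restrict Q) (restrict_is_linear Q).

Lemma pseries_restrict n k Q a : pseries P n k a -> pseries P n k (restrict Q a).
Proof.
apply: pseries_sub => p a0; apply/ffunP => S.
by rewrite /restrict a0 !ffunE if_same.
Qed.

Lemma Ahat_component d a : Ahat P a -> Ahat P (component d a).
Proof. by move=> [n _ ha]; exists n => //; exact: pseries_restrict. Qed.

Lemma sum_restrict (I : finType) (phi : {set 'I_r} -> I) a :
  a = \sum_i restrict (fun S => phi S == i) a.
Proof.
apply/funext => p; apply/ffunP => S.
rewrite fct_sumE sum_ffunE (bigD1 (phi S)) //= ffunE eqxx big1 ?addr0 // => i.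
by rewrite eq_sym ffunE => /negbTE ->.
Qed.

Lemma sum_component a : a = \sum_(d < r.+1) component d a.
Proof.
rewrite {1}(sum_restrict (fun S => inord #|S| : 'I_r.+1) a).
apply: eq_bigr => d _; apply/funext => p; apply/ffunP => S; rewrite !ffunE.
by rewrite -(inj_eq val_inj) /= inordK // ltnS -[r in (_ <= r)%N]card_ord max_card.
Qed.

Lemma eq_components a b : (forall d, component d a = component d b) -> a = b.
Proof.
move=> h; rewrite (sum_component a) (sum_component b).
by apply: eq_bigr => d _; exact: h.
Qed.

Lemma homog_component d a : homog d (component d a).
Proof. by move=> p S; rewrite ffunE; case: ifP => [/eqP|_]; rewrite ?eqxx. Qed.

Lemma component_homog d e a : homog e a ->
  component d a = if d == e then a else 0.
Proof.
move=> ha; apply/funext => p; apply/ffunP => S; rewrite ffunE.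
have [aS|/ha ->] := eqVneq (a p S) 0; last first.
  by rewrite eq_sym; case: ifP => // _; rewrite ffunE.
by rewrite aS if_same; case: ifP => // _; rewrite ?ffunE.
Qed.

Lemma homogE d a : homog d a <-> component d a = a.
Proof.
split=> [/(component_homog d)->|<-]; first by rewrite eqxx.
exact: homog_component.
Qed.

Definition monomial n : pv r R := mono n (ext_one r R).

Lemma homog_monomial n : homog 0 (monomial n).
Proof.
move=> p S; rewrite /monomial /mono; case: (p == n); rewrite ffunE ?eqxx //.
by case: (eqVneq S finset.set0) => [->|_]; rewrite ?cards0 ?eqxx.
Qed.

Lemma pseries_monomial n : pseries P n 0 (monomial n).
Proof. exact: pseries_mono. Qed.

Lemma laurent_monomial n : laurent P (monomial n).
Proof.
split; last exact: homog_monomial.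
by exists n => //; exact: pseries_monomial.
Qed.

Lemma act_monomial a n p : act a (monomial n) p = contract n (a (p - n)).
Proof.
rewrite /act (fsum_single (t := n)).
  by rewrite /monomial /mono eqxx ext_oneE eqxx scale1r.
by move=> q /eqP/negbTE qn; rewrite /monomial /mono qn ffunE scale0r.
Qed.

(** A nonempty S contains some i, and the coefficient of x at S is, up to sign, that of its
    contraction by e_i at S without i. *)
Lemma contract_basis_eq0 (x : ext r R) : x finset.set0 = 0 ->
  (forall i, contract (basis_vec i) x = 0) -> x = 0.
Proof.
move=> x0 hx; apply/ffunP => S; rewrite [RHS]ffunE.
have [->//|[i iS]] := finset.set_0Vmem S.
have := congr1 (fun y : ext r R => y (S :\ i)) (hx i).
rewrite contract_basis !inE eqxx /= finset.setD1K // ffunE.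
move=> /(congr1 ( *%R ((-1) ^+ inv_count (S :\ i) i))).
by rewrite mulrA -signr_odd -expr2 sqrr_sign mul1r mulr0.
Qed.

Lemma homogS_set0 d a p : homog d.+1 a -> a p finset.set0 = 0.
Proof. by move=> ha; apply: contraTeq isT => /ha; rewrite cards0. Qed.

Lemma act_homogS d a f : homog d.+1 a -> homog d (act a f).
Proof.
move=> ha p S; apply: contraNeq => Sd.
rewrite /act; elim/big_ind : _ => [|x y /eqP x0 /eqP y0|q _]; first by rewrite ffunE.
  by rewrite ffunE x0 y0 addr0.
rewrite !ffunE big1 ?scaler0 // => i iS.
have [->|/ha] := eqVneq (a (p - q) (i |: S)) 0; first by rewrite mulr0.
by rewrite cardsU1 iS add1n => -[] /eqP; rewrite (negbTE Sd).
Qed.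

Lemma act_homog0 a f : homog 0 a -> act a f = 0.
Proof.
move=> ha; apply/funext => p; apply: fsbig1 => q _.
apply/ffunP => S; rewrite !ffunE big1 ?scaler0 // => i iS.
have [->|/ha] := eqVneq (a (p - q) (i |: S)) 0; first by rewrite mulr0.
by rewrite cardsU1 iS.
Qed.

Lemma act_inj d a b : homog d.+1 a -> homog d.+1 b ->
  (forall f, laurent P f -> act a f = act b f) -> a = b.
Proof.
move=> ha hb hab; apply/eqP; rewrite -subr_eq0; apply/eqP/funext => p.
apply: contract_basis_eq0 => [|i].
  by rewrite !fctE !ffunE (homogS_set0 _ ha) (homogS_set0 _ hb) subr0.
have := congr1 (fun c : pv r R => c (p + basis_vec i))
  (hab _ (laurent_monomial (basis_vec i))).
rewrite !act_monomial addrK !fctE linearB /= => ->; exact: subrr.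
Qed.

(** Every exponent p of a reappears as p + e_i in the action on z^(e_i) for some i. As there are
    finitely many i, the finiteness condition descends along with the order. *)
Lemma pseries_act_monomial d n k a : homog d.+1 a ->
  (forall i, pseries P (n + basis_vec i) k (act a (monomial (basis_vec i)))) ->
  pseries P n k a.
Proof.
move=> ha hi.
have hp p : a p <> 0 ->
    exists i, act a (monomial (basis_vec i)) (p + basis_vec i) <> 0.
  move=> ap; apply: contrapT => /forallNP h; apply: ap.
  apply: contract_basis_eq0 => [|i]; first exact: homogS_set0 ha.
  by have /contrapT := h i; rewrite act_monomial addrK.
split=> [p /hp[i /(hi i).1]|j]; first by rewrite opprD addrACA subrr addr0.
have fin i := (hi i).2 j.
apply: (@sub_finite_set _ _ (\bigcup_(i in [set: 'I_r]) ((fun p => p - basis_vec i) @`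
  [set p | act a (monomial (basis_vec i)) p <> 0
    /\ ~ mpow P j (p - (n + basis_vec i))]))).
  move=> p [/hp[i ai] hj]; exists i => //; exists (p + basis_vec i); last exact: addrK.
  by split=> //; rewrite opprD addrACA subrr addr0.
by apply: bigcup_finite => [|i _]; [exact: finite_finset|exact: finite_image].
Qed.

End Degree.

(** * The Schouten-Nijenhuis bracket with a function and with a vector field *)

Section Schouten.
Variables (r : nat) (R : comPzRingType) (P : set 'rV[int]_r).
Hypothesis P0 : P 0.
Hypothesis PD : forall x y, P x -> P y -> P (x + y).
Hypothesis P_separated : adically_separated P.
Implicit Types (a b c f : pv r R) (n m p q : 'rV[int]_r).

(** The invariant vector field z_i d/dz_i of the torus. *)
Definition covec_field (i : 'I_r) : pv r R := mono 0 (covec R (basis_vec i)).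

Lemma homog_covec_field i : homog 1 (covec_field i).
Proof.
move=> p S; rewrite /covec_field /mono; case: (p == 0); last by rewrite ffunE eqxx.
have [[j /eqP ->]|h] := pselect (exists j, S == [set j]%SET); first by rewrite cards1.
by rewrite ffunE big1 ?eqxx // => j Sj; case: h; exists j.
Qed.

Lemma Ahat_mono n (x : ext r R) : Ahat P (mono n x).
Proof. by exists n => //; exact: pseries_mono. Qed.

Lemma pvmul_covec_field i c p :
  pvmul (covec_field i) c p = wedge (covec R (basis_vec i)) (c p).
Proof.
rewrite /pvmul (fsum_single (t := 0)); first by rewrite /covec_field /mono eqxx subr0.
by move=> q /eqP/negbTE q0; rewrite /covec_field /mono q0 wedge0l.
Qed.

Lemma act_covec_field i f q :
  act (covec_field i) f q
  = (f q finset.set0 * (q 0 i)%:~R) *: ext_one r R.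
Proof.
rewrite /act (fsum_single (t := q)); last first.
  move=> q' q'q; rewrite /covec_field /mono ifF; first by rewrite linear0 scaler0.
  by apply/eqP => /eqP; rewrite subr_eq0 => /eqP qq'; apply: q'q.
by rewrite subrr /covec_field /mono eqxx contract_covec scalerA.
Qed.

Lemma pvmulNl a b : Ahat P a -> Ahat P b -> pvmul (- a) b = - pvmul a b.
Proof.
move=> [n _ ha] [m _ hb]; apply/funext => p; rewrite !fctE /pvmul.
have [s hs] := conv_sum PD P_separated p hb ha.
have wN x y : wedge (- x) y = - wedge x y :> ext r R.
  apply/ffunP => U; rewrite !ffunE -sumrN; apply: eq_bigr => S _.
  by rewrite ffunE mulrN mulNr.
rewrite !hs; first by rewrite -sumrN; apply: eq_bigr => q _; rewrite wN.
- by move=> q [->|->]; rewrite ?wedge0l ?linear0.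
- by move=> q [aq|->]; rewrite ?linear0 // aq oppr0 wedge0l.
Qed.

(** This is the antiderivation rule for the contraction by q, summed over the monomials z^q of f. *)
Lemma act_wedge_covec i c f : Ahat P c -> Ahat P f ->
  act (pvmul (covec_field i) c) f
  = pvmul (act (covec_field i) f) c - pvmul (covec_field i) (act c f).
Proof.
move=> [n _ hc] [m _ hf]; apply/funext => p.
have [s hs] := conv_sum PD P_separated p hc hf.
rewrite !fctE pvmul_covec_field.
have -> : pvmul (act (covec_field i) f) c p
    = \sum_(q \in [set: 'rV[int]_r]) (f q finset.set0 * (q 0 i)%:~R) *: c (p - q).
  by apply: eq_fsbigr => q _; rewrite act_covec_field wedge_scalarl.
rewrite /act !hs.
- rewrite linear_sum /= -sumrB; apply: eq_bigr => q _.
  rewrite pvmul_covec_field contract_wedge_covec.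
  by rewrite linearZ scalerBr scalerA.
- by move=> q [->|->]; rewrite ?ffunE ?scale0r // linear0 scaler0.
- by move=> q [->|->]; rewrite ?ffunE ?mul0r ?scale0r ?scaler0.
- move=> q [->|c0]; rewrite ?ffunE ?scale0r //.
  by rewrite pvmul_covec_field c0 !linear0.
Qed.

Variable br : pv r R -> pv r R -> pv r R.
Hypothesis brP : schouten_nijenhuis P br.

Lemma br_linear n a : Ahat P a -> linear_on P n (br a).
Proof.
by move=> ha s b c hb hc; apply: (sn_linr brP) => //; exists n.
Qed.

Lemma br_homog1 d a b : Ahat P a -> Ahat P b -> homog 1 a -> homog d b ->
  homog d (br a b).
Proof.
move=> ha hb da eb p S /(sn_degree brP ha hb da eb).
by rewrite add1n => -[->].
Qed.

Lemma br_laurent a f : Ahat P a -> homog 1 a -> laurent P f -> laurent P (br a f).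
Proof.
by move=> ha da [hf df]; split; [exact: sn_closed brP _ _ _ _|exact: br_homog1].
Qed.

(* Peeling off one covector e_i at a time, the Leibniz rule reduces the claim to
   the bracket of two functions, which vanishes for degree reasons. *)
Lemma br_fun_single f (S : {set 'I_r}) a : laurent P f -> Ahat P a ->
  (forall p U, a p U != 0 -> U = S) -> br f a = - act a f.
Proof.
move=> hf; have [fA f0] := hf.
move cE : #|S| => c; elim: c => [|c IH] in S a cE *.
  move=> ha aS; have S0 := cards0_eq cE.
  have a0 : homog 0 a by move=> p U /aS ->.
  rewrite act_homog0 // oppr0; apply/funext => p; apply/ffunP => U.
  apply/eqP; rewrite ffunE; apply: contraT => /(sn_degree brP fA ha f0 a0).
  by [].
move=> ha aS; have /card_gt0P[i iS] : (0 < #|S|)%N by rewrite cE.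
pose c' : pv r R := fun p => contract (basis_vec i) (a p).
have hc' : Ahat P c'.
  case: ha => n _ ha; exists n => //; apply: pseries_sub ha => p ap.
  by rewrite /c' ap linear0.
have cS p U : c' p U != 0 -> U = S :\ i.
  rewrite /c' contract_basis; case: ifP => iU; first by rewrite eqxx.
  have [->|/aS <- _] := eqVneq (a p (i |: U)) 0; first by rewrite mulr0 eqxx.
  by rewrite finset.setU1K ?iU.
(* As i lies in S, e_i /\ a = 0, and the antiderivation rule for the contraction by e_i leaves a =
   e_i /\ c'. *)
have aE : a = pvmul (covec_field i) c'.
  apply/funext => p; rewrite pvmul_covec_field.
  have := contract_wedge_covec (basis_vec i) i (a p).
  rewrite mxE !eqxx scale1r [wedge _ (a p)](_ : _ = 0) ?linear0.
    by move/eqP; rewrite eq_sym subr_eq0 => /eqP.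
  apply/ffunP => U; rewrite wedge_covec ffunE; case: ifP => // iU.
  have [->|/aS US] := eqVneq (a p (U :\ i)) 0; first by rewrite mulr0.
  by move: iS; rewrite -US !inE eqxx.
have hi : homog 1 (covec_field i) by exact: homog_covec_field.
   have Ai : Ahat P (covec_field i) by exact: Ahat_mono.
(* Antisymmetry gives [f, e_i] = - e_i(f), and the Leibniz sign for a function and e_i is -1. With
   the induction hypothesis, [f, e_i /\ c'] = - e_i(f) c' + e_i /\ c'(f). *)
rewrite aE (sn_leibniz brP fA Ai hc' f0 hi) (sn_antisym brP fA Ai f0 hi).
rewrite (sn_fun brP Ai hi hf) (IH (S :\ i)) //; last first.
  by apply/eqP; rewrite -eqSS -cE (cardsD1 i S) iS.
rewrite act_wedge_covec // opprB addrC mul1n sqrrN expr1n scale1r pvmulNl //; last first.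
  case: fA => m _ hfA; apply: (pseries_Ahat PD); apply: pseries_act hfA => //.
  exact: pseries_mono.
congr (_ + _); rewrite expr1 scaleN1r; apply/funext => p.
by rewrite !fctE !pvmul_covec_field linearN /= opprK.
Qed.

(** The finitely many parts of a along single e_S share one offset n, so [br] and the action may be
    distributed over their sum. *)
Lemma br_fun f a : laurent P f -> Ahat P a -> br f a = - act a f.
Proof.
move=> hf [n _ ha]; have [[m _ fm] f0] := hf.
rewrite (sum_restrict id a).
have h i : true -> pseries P n 0 (restrict (fun S => S == i) a).
  by move=> _; exact: pseries_restrict.
under eq_bigr do rewrite -[restrict _ _]scale1r.
rewrite (linear_on_sum (br_linear (n := n) hf.1)) //.
rewrite (linear_on_sum (act_linearl (n := n) PD P_separated fm)) // -sumrN.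
apply: eq_bigr => S _; rewrite !scale1r.
apply: (br_fun_single (S := S) hf (pseries_Ahat PD (h S isT))) => p U.
by rewrite ffunE; case: ifP => [/eqP|]; rewrite ?eqxx.
Qed.

Lemma br_act g a f : Ahat P g -> homog 1 g -> Ahat P a -> laurent P f ->
  br g (act a f) = act (br g a) f + act a (br g f).
Proof.
move=> hg dg ha hf; have [fA f0] := hf.
have gf := br_laurent hg dg hf.
have ga : Ahat P (br g a) by exact: sn_closed brP _ _ hg ha.
have fa : Ahat P (br f a) by exact: sn_closed brP _ _ fA ha.
have aE c h : Ahat P c -> laurent P h -> act c h = - br h c.
  by move=> hc hh; rewrite br_fun // opprK.
rewrite !aE // -scaleN1r; have [n _ hn] := fa.
rewrite (linear_onZ (br_linear (n := n) hg)) ?scaleN1r //.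
by rewrite (sn_jacobi brP hg fA ha dg f0) sqrrN expr1n scale1r opprD addrC.
Qed.

Lemma br_filtration_homog g d n k a : pseries P 0 1 g -> homog 1 g ->
  homog d a -> pseries P n k a -> pseries P n k.+1 (br g a).
Proof.
move=> hg dg; have Ag : Ahat P g by exact: (pseries_Ahat PD hg).
elim: d n k a => [|d IH] n k a da ha; have Aa := pseries_Ahat PD ha.
  rewrite (sn_fun brP) //; have := pseries_act PD hg ha.
  by rewrite addr0 addn1.
apply: (pseries_act_monomial (d := d)) => [|i]; first exact: br_homog1.
set z := monomial _ _; have hz : laurent P z by exact: laurent_monomial.
have z0 : pseries P (basis_vec i) 0 z by exact: pseries_monomial.
have -> : act (br g a) z = br g (act a z) - act a (br g z).
  by rewrite br_act // addrK.
rewrite addrC; apply: pseriesB => //.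
  apply: IH; first exact: act_homogS.
  by have := pseries_act PD ha z0; rewrite add0n.
(* On the function z the bracket is the action of g, which has order 1; a then adds its own order
   k. *)
rewrite (sn_fun brP) //.
have := pseries_act PD ha (pseries_act PD hg z0).
by rewrite addr0.
Qed.

Lemma br_component g d a : Ahat P g -> homog 1 g -> Ahat P a ->
  br g (component d a) = component d (br g a).
Proof.
move=> hg dg [n _ ha].
have hc e : pseries P n 0 (component e a) by exact: pseries_restrict.
rewrite {2}(sum_component a).
under [X in _ = component _ (br g X)]eq_bigr do rewrite -[component _ _]scale1r.
rewrite (linear_on_sum (br_linear (n := n) hg)) // [RHS]componentE linear_sum /=.
under eq_bigr => e _.
  rewrite scale1r -componentE (@component_homog _ _ _ e); last first.
    apply: br_homog1 => //; last exact: homog_component.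
    exact: (pseries_Ahat PD (hc e)).
  over.
have [dr|dr] := ltnP d r.+1.
  rewrite (bigD1 (Ordinal dr)) //= eqxx big1 ?addr0 // => e /negbTE.
  by rewrite -(inj_eq val_inj) /= eq_sym => ->.
rewrite big1 => [|e _]; last by rewrite gtn_eqF // (leq_trans (ltn_ord e)).
(* There is no component of degree d > r, and [br g] sends 0 to 0 by linearity. *)
rewrite [component d a](_ : _ = 0) ?(linear_on0 (br_linear (n := 0) hg)) //.
apply/funext => p; apply/ffunP => S; rewrite !ffunE; case: eqP => // Sd.
by move: dr; rewrite -Sd leqNgt ltnS -[r in (_ <= r)%N]card_ord max_card.
Qed.

Lemma br_filtration g n k a : pseries P 0 1 g -> homog 1 g ->
  pseries P n k a -> pseries P n k.+1 (br g a).
Proof.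
move=> hg dg ha; rewrite (sum_component a).
have Ag : Ahat P g by exact: (pseries_Ahat PD hg).
under eq_bigr do rewrite -[component _ _]scale1r.
rewrite (linear_on_sum (br_linear (n := n) Ag)) => [|d _]; last first.
  by apply: pseries_restrict; apply: pseriesW ha.
apply: pseries_sum => // d _; rewrite scale1r.
by apply: br_filtration_homog => //; [exact: homog_component|exact: pseries_restrict].
Qed.

End Schouten.

(* Z need not be additive: only the sums that occur are distributed. *)
Lemma iter_binomial (R : pzRingType) (V : lmodType R) (Z : V -> V)
    (T : nat -> nat -> V) :
  (forall N, Z (\sum_(i < N.+1) 'C(N, i)%:R *: T i (N - i)%N)
   = \sum_(i < N.+1) 'C(N, i)%:R *: (T i.+1 (N - i)%N + T i (N - i).+1)) ->
  forall N, iter N Z (T 0%N 0%N) = \sum_(i < N.+1) 'C(N, i)%:R *: T i (N - i)%N.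
Proof.
move=> hZ; elim=> [|N IH]; first by rewrite big_ord1 bin0 scale1r.
rewrite iterS {}IH {}hZ; under eq_bigr do rewrite scalerDr.
rewrite big_split /= [X in _ + X]big_ord_recl [in RHS]big_ord_recl /= !bin0 !subn0 addrCA.
congr (_ + _); rewrite [in RHS](eq_bigr (fun i : 'I_N.+1 =>
  'C(N, i)%:R *: T i.+1 (N - i)%N + 'C(N, i.+1)%:R *: T i.+1 (N - i)%N)); last first.
  by move=> i _; rewrite /bump /= add1n binS natrD scalerDl addrC subSS.
rewrite big_split; congr (_ + _); rewrite [in RHS]big_ord_recr /=.
rewrite bin_small // scale0r addr0; apply: eq_bigr => i _.
by rewrite /bump /= add1n subnSK.
Qed.

(** * Exponentials of operators that raise the filtration *)

Section Exponential.
Variables (r : nat) (R : comPzRingType) (P : set 'rV[int]_r).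
Hypothesis P0 : P 0.
Hypothesis PD : forall x y, P x -> P y -> P (x + y).
Hypothesis P_separated : adically_separated P.
Variable iota : {rmorphism rat -> R}.
Implicit Types (a b f : pv r R) (n m : 'rV[int]_r) (D : pv r R -> pv r R).

Local Notation c j := (iota (j`!%:R^-1)).

Definition exp_partial D J a : pv r R := \sum_(j < J) c j *: iter j D a.

(** The offset n is the same before and after [D], so all iterates and partial sums of the
    exponential stay in a single z^n R[[P]]. *)
Definition filtered_op D := (forall n, linear_on P n D) /\
  (forall n k a, pseries P n k a -> pseries P n k.+1 (D a)).

Lemma inv_fact_binomial N i : (i <= N)%N -> c N * 'C(N, i)%:R = c i * c (N - i)%N.
Proof.
move=> iN; rewrite -(rmorph_nat iota) -!rmorphM; congr (iota _).
rewrite -(bin_fact iN) !natrM !invfM mulrAC mulVf ?mul1r //.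
by rewrite pnatr_eq0 -lt0n bin_gt0.
Qed.

(* Z plays the role of D (x) 1 + 1 (x) D on the products T i j = D^i x . D^j y. *)
Lemma exp_product n (Z : pv r R -> pv r R) (T : nat -> nat -> pv r R) J :
  (forall N, Z (\sum_(i < N.+1) 'C(N, i)%:R *: T i (N - i)%N)
   = \sum_(i < N.+1) 'C(N, i)%:R *: (T i.+1 (N - i)%N + T i (N - i).+1)) ->
  (forall i j, pseries P n (i + j) (T i j)) ->
  pseries P n J (\sum_(i < J) \sum_(j < J) (c i * c j) *: T i j
                 - exp_partial Z J (T 0%N 0%N)).
Proof.
move=> hZ hT; rewrite (sum_square_triangle J (fun i j => (c i * c j) *: T i j)).
rewrite /exp_partial addrAC -sumrB big1 ?add0r => [|N _].
  apply: pseries_sum => i _; apply: pseries_sum => j hij.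
  exact/pseriesZ/(pseriesW PD hij).
rewrite (iter_binomial hZ) scaler_sumr; apply/eqP; rewrite subr_eq0; apply/eqP.
by apply: eq_bigr => i _; rewrite scalerA inv_fact_binomial // -ltnS.
Qed.

Lemma iter_linear_on D j n : filtered_op D -> linear_on P n (iter j D).
Proof.
move=> [Dl Du]; have up i a : pseries P n 0 a -> pseries P n 0 (iter i D a).
  by move=> ha; elim: i => //= i /Du; exact: pseriesW.
by elim: j => // j IH s a b ha hb; rewrite !iterS IH // (Dl n) //; exact: up.
Qed.

Lemma pseries_iter D j n k a : filtered_op D -> pseries P n k a ->
  pseries P n (j + k) (iter j D a).
Proof. by move=> [_ Du] ha; elim: j => //= j /Du. Qed.

Lemma pseries_exp_partial D J n k a : filtered_op D -> pseries P n k a ->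
  pseries P n k (exp_partial D J a).
Proof.
move=> hD ha; apply: pseries_sum => j _; apply: pseriesZ.
by apply: pseriesW (pseries_iter j hD ha); rewrite ?leq_addl.
Qed.

(** The j-th term of the series has order at least j. This error bound stands in for continuity when
    exponentials are compared. *)
Lemma exp_opP D n a J : filtered_op D -> pseries P n 0 a ->
  pseries P n J (exp_op P iota D a - exp_partial D J a).
Proof.
move=> hD ha.
have [|l hl] := pseries_series PD P_separated (n := n)
  (x := fun j => c j *: iter j D a).
  by move=> j; apply: pseriesZ; have := pseries_iter j hD ha; rewrite addn0.
have h0 : pseries P n 0 l by have := hl 0%N; rewrite big_ord0 subr0.
suff -> : exp_op P iota D a = l by exact: hl.
by apply: (adic_limE PD P_separated (n := n)) hl; exists n.
Qed.

Lemma pseries_exp_op D n a : filtered_op D -> pseries P n 0 a ->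
  pseries P n 0 (exp_op P iota D a).
Proof. by move=> hD ha; have := exp_opP 0 hD ha; rewrite /exp_partial big_ord0 subr0. Qed.

Lemma Ahat_exp_op D a : filtered_op D -> Ahat P a -> Ahat P (exp_op P iota D a).
Proof. by move=> hD [n _ ha]; exists n => //; exact: pseries_exp_op. Qed.

Lemma pseries_subC n k a b : pseries P n k (a - b) -> pseries P n k (b - a).
Proof. by move=> h; rewrite -opprB; exact: pseriesN. Qed.

Lemma pseries_trans n k b a a' :
  pseries P n k (a - b) -> pseries P n k (b - a') -> pseries P n k (a - a').
Proof. by move=> h h'; rewrite -(subrKA b); exact: pseriesD. Qed.

Lemma filtered_opN D : filtered_op D -> filtered_op (fun a => - D a).
Proof.
move=> [Dl Du]; split=> [n s a b ha hb|n k a /Du]; last exact: pseriesN.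
by rewrite (Dl n) // opprD scalerN.
Qed.

(* D + (- D) = 0 acts on T i j = D^i (- D)^j a by the Leibniz rule required in
   exp_product, so exp D (exp (- D) a) = exp 0 a. *)
Lemma exp_opN D a : filtered_op D -> Ahat P a ->
  exp_op P iota D (exp_op P iota (fun b => - D b) a) = a.
Proof.
move=> hD [n _ ha]; have hN := filtered_opN hD; set D' := fun b => - D b in hN *.
have hE := pseries_exp_op hN ha.
apply: (pseries_eq P_separated (n := n)) => J.
(* J is made positive: a partial sum of exp 0 equals a only if it contains the term of index 0. *)
apply: (pseriesW PD (leqnSn J)); move: J.+1 (ltn0Sn J) => {}J J0.
apply: (pseries_trans (exp_opP J hD hE)).
have hl := pseries_exp_partial J hN ha.
apply: (@pseries_trans _ _ (exp_partial D J (exp_partial D' J a))).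
  have -> : exp_partial D J (exp_op P iota D' a) - exp_partial D J (exp_partial D' J a)
      = exp_partial D J (exp_op P iota D' a - exp_partial D' J a).
    rewrite /exp_partial -sumrB; apply: eq_bigr => j _.
    by rewrite -scalerBr (linear_onB (iter_linear_on j (n := n) hD)).
  by apply: pseries_exp_partial => //; exact: exp_opP.
pose T i j := iter i D (iter j D' a).
have TS i j : T i.+1 j + T i j.+1 = 0.
  rewrite /T iterSr [iter j.+1 D' a]iterS /D' -scaleN1r.
  rewrite (linear_onZ (iter_linear_on i (n := n) hD)) ?scaleN1r ?subrr //.
  apply: (pseriesW PD (leq0n (j + 0).+1)); apply: hD.2.
  exact: pseries_iter.
have TP i j : pseries P n (i + j) (T i j).
  by have := pseries_iter i hD (pseries_iter j hN ha); rewrite addn0.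
have -> : exp_partial D J (exp_partial D' J a)
    = \sum_(i < J) \sum_(j < J) (c i * c j) *: T i j.
  rewrite {1}/exp_partial; apply: eq_bigr => i _.
  rewrite (linear_on_sum (iter_linear_on i (n := n) hD)) => [|j _].
    by rewrite scaler_sumr; apply: eq_bigr => j _; rewrite scalerA.
  by apply: pseriesW (pseries_iter j hN ha).
have -> : a = exp_partial (fun=> 0) J a.
  case: (J) J0 => // J' _; rewrite /exp_partial big_ord_recl big1 ?addr0 => [|j _].
    by rewrite fact0 invr1 rmorph1 scale1r.
  by rewrite /= scaler0.
apply: (exp_product (T := T)) => // N.
by rewrite big1 // => i _; rewrite TS scaler0.
Qed.

(** Replacing each exponential by its J-th partial sum costs an error of order J. What remains is a
    Cauchy product with T i j = (D^i a)(D^j f), on which the assumed Leibniz rule is the rule that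
    [exp_product] requires. *)
Lemma exp_op_act D a f : filtered_op D -> Ahat P a -> laurent P f ->
  (forall h, laurent P h -> laurent P (D h)) ->
  (forall b h, Ahat P b -> laurent P h -> D (act b h) = act (D b) h + act b (D h)) ->
  exp_op P iota D (act a f) = act (exp_op P iota D a) (exp_op P iota D f).
Proof.
move=> hD [n _ ha] Lf DL Dact; have [[m _ hf] _] := Lf.
have hE b k : pseries P k 0 b -> pseries P k 0 (exp_op P iota D b).
  exact: pseries_exp_op.
have hp J b k : pseries P k 0 b -> pseries P k 0 (exp_partial D J b).
  exact: pseries_exp_partial.
have haf := pseries_act PD ha hf; rewrite addn0 in haf.
apply: (pseries_eq P_separated (n := m + n)) => J.
apply: (pseries_trans (exp_opP J hD haf)); apply: pseries_subC.
apply: (@pseries_trans _ _ (act (exp_partial D J a) (exp_op P iota D f))).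
  rewrite -(linear_onB (act_linearl PD P_separated (n := n) (hE _ _ hf))) //;
    try exact: hE; try exact: hp.
  by have := pseries_act PD (exp_opP J hD ha) (hE _ _ hf).
apply: (@pseries_trans _ _ (act (exp_partial D J a) (exp_partial D J f))).
  rewrite -(linear_onB (act_linearr PD P_separated (n := m) (hp J _ _ ha))) //;
    try exact: hE; try exact: hp.
  by have := pseries_act PD (hp J _ _ ha) (exp_opP J hD hf); rewrite addn0.
pose T i j := act (iter i D a) (iter j D f).
have hi i k b : pseries P k 0 b -> pseries P k i (iter i D b).
  by move=> hb; have := pseries_iter i hD hb; rewrite addn0.
have TP i j : pseries P (m + n) (i + j) (T i j).
  by rewrite addnC; apply: pseries_act => //; exact: hi.
have -> : act (exp_partial D J a) (exp_partial D J f)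
    = \sum_(i < J) \sum_(j < J) (c i * c j) *: T i j.
  have linl := act_linearl PD P_separated (n := n) (hp J _ _ hf).
  rewrite {1}/exp_partial (linear_on_sum linl) => [|i _]; last first.
    by apply: pseriesW (hi i _ _ ha).
  apply: eq_bigr => i _; have hi0 := pseriesW PD (leq0n i) (hi i _ _ ha).
  rewrite (linear_on_sum (act_linearr PD P_separated (n := m) hi0)) => [|j _]; last first.
    by apply: pseriesW (hi j _ _ hf).
  by rewrite scaler_sumr; apply: eq_bigr => j _; rewrite scalerA.
apply: (exp_product (Z := D) (T := T)) => // N.
rewrite (linear_on_sum (hD.1 (m + n))) => [|i _].
  apply: eq_bigr => i _; congr (_ *: _); apply: Dact.
    by apply: (pseries_Ahat PD); exact: hi ha.
  by elim: (N - i)%N => //= j; exact: DL.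
by apply: pseriesW (TP _ _).
Qed.

Lemma exp_op_component D d a : filtered_op D -> Ahat P a ->
  (forall b, Ahat P b -> D (component d b) = component d (D b)) ->
  exp_op P iota D (component d a) = component d (exp_op P iota D a).
Proof.
move=> hD [n _ ha] Dc; apply: (pseries_eq P_separated (n := n)) => J.
have hca : pseries P n 0 (component d a) by exact: pseries_restrict.
apply: (pseries_trans (exp_opP J hD hca)).
have -> : exp_partial D J (component d a) = component d (exp_partial D J a).
  rewrite /exp_partial [RHS]componentE linear_sum.
  apply: eq_bigr => j _ /=; rewrite linearZ /=.
  congr (_ *: _); elim: (j : nat) => //= i ->; rewrite -componentE Dc //.
  by apply: (pseries_Ahat PD); exact: (pseries_iter i hD ha).
apply: pseries_subC; rewrite !componentE -linearB.
apply: pseries_restrict; exact: exp_opP.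
Qed.

End Exponential.

(** * Uniqueness of pushforwards, and automorphisms of [Ahat] that compute them *)

Section Pushforward.
Variables (r : nat) (R : comPzRingType) (P : set 'rV[int]_r).
Hypothesis P0 : P 0.
Hypothesis PD : forall x y, P x -> P y -> P (x + y).
Hypothesis P_separated : adically_separated P.
Implicit Types (a b f : pv r R) (phi E : pv r R -> pv r R).

Lemma Ahat_act a f : Ahat P a -> Ahat P f -> Ahat P (act a f).
Proof.
by move=> [n _ ha] [m _ hf]; exists (m + n) => //; have := pseries_act PD ha hf.
Qed.

Lemma pushforward_deg_unique phi d a b b' :
  homog d b -> homog d b' ->
  is_pushforward_deg P phi d a b -> is_pushforward_deg P phi d a b' -> b = b'.
Proof.
elim: d a b b' => [|d IH] a b b' hb hb' /=; first by move=> -> ->.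
move=> h h'; apply: (act_inj P0 hb hb') => f hf.
by apply: IH (h f hf) (h' f hf); exact: act_homogS.
Qed.

Lemma pushforward_unique phi a b b' :
  is_pushforward P phi a b -> is_pushforward P phi a b' -> b = b'.
Proof.
move=> [_ hb] [_ hb']; apply: eq_components => d.
by apply: pushforward_deg_unique (hb d) (hb' d); exact: homog_component.
Qed.

(** E extends phi from functions to all of [Ahat], with inverse E'. The map phi is kept apart from E
    because the two are compared on Laurent series only; elsewhere a wall crossing uses the action
    instead of the bracket, and [phi_inv] is built from Laurent series alone. *)
Record extends_auto phi E E' : Prop := ExtendsAuto {
  ext_Ahat : forall a, Ahat P a -> Ahat P (E a);
  ext_Ahat_inv : forall a, Ahat P a -> Ahat P (E' a);
  extK : forall a, Ahat P a -> E' (E a) = a;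
  extVK : forall a, Ahat P a -> E (E' a) = a;
  ext_component : forall d a, Ahat P a -> E (component d a) = component d (E a);
  ext_act : forall a f, Ahat P a -> laurent P f -> E (act a f) = act (E a) (E f);
  ext_fun : forall f, laurent P f -> phi f = E f }.

Lemma ext_component_inv phi E E' d a : extends_auto phi E E' -> Ahat P a ->
  E' (component d a) = component d (E' a).
Proof.
move=> h ha; have hE' := ext_Ahat_inv h ha.
by rewrite -{1}(extVK h ha) -(ext_component h) // (extK h) //; exact: Ahat_component.
Qed.

Lemma ext_laurent_inv phi E E' f : extends_auto phi E E' -> laurent P f ->
  laurent P (E' f).
Proof.
move=> h [hf /homogE f0]; split; first exact: (ext_Ahat_inv h hf).
by apply/homogE; rewrite -(ext_component_inv _ h) ?f0.
Qed.

Lemma ext_laurent phi E E' f : extends_auto phi E E' -> laurent P f ->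
  laurent P (E f).
Proof.
move=> h [hf /homogE f0]; split; first exact: (ext_Ahat h hf).
by apply/homogE; rewrite -(ext_component h) ?f0.
Qed.

(** The partial inverse is meaningful only on values of phi at Laurent series: E' provides
    injectivity there, and f = phi (E' f) exhibits f as such a value. *)
Lemma phi_invE phi E E' f : extends_auto phi E E' -> laurent P f ->
  phi_inv P phi f = E' f.
Proof.
move=> h hf; have hf' := ext_laurent_inv h hf.
have inj : {in laurent P &, injective phi}.
  move=> x y /set_mem hx /set_mem hy; rewrite !(ext_fun h) // => xy.
  by rewrite -(extK h hx.1) xy (extK h hy.1).
rewrite -{1}(extVK h hf.1) -(ext_fun h) // /phi_inv pinvKV //.
exact: mem_set.
Qed.

Lemma extends_auto_id : extends_auto id id id.
Proof. by []. Qed.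

Lemma extends_auto_inv phi E E' :
  extends_auto phi E E' -> extends_auto (phi_inv P phi) E' E.
Proof.
move=> h; split; try by case: h.
- by move=> d a; exact: ext_component_inv h.
- move=> a f ha hf; have ha' := ext_Ahat_inv h ha; have hf' := ext_laurent_inv h hf.
  rewrite -{1}(extVK h ha) -{1}(extVK h hf.1) -(ext_act h) // (extK h) //.
  exact: Ahat_act ha' hf'.1.
- by move=> f; exact: phi_invE h.
Qed.

Lemma extends_auto_comp phi E E' psi F F' : extends_auto phi E E' ->
  extends_auto psi F F' -> extends_auto (psi \o phi) (F \o E) (E' \o F').
Proof.
move=> h k; split=> /=.
- by move=> a /(ext_Ahat h); exact: (ext_Ahat k).
- by move=> a /(ext_Ahat_inv k); exact: (ext_Ahat_inv h).
- by move=> a ha; rewrite (extK k) ?(extK h) //; exact: (ext_Ahat h ha).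
- by move=> a ha; rewrite (extVK h) ?(extVK k) //; exact: (ext_Ahat_inv k ha).
- move=> d a ha; rewrite (ext_component h) // (ext_component k) //.
  exact: (ext_Ahat h ha).
- move=> a f ha hf; rewrite (ext_act h) // (ext_act k) //; first exact: (ext_Ahat h ha).
  exact: ext_laurent h hf.
- by move=> f hf; rewrite (ext_fun h) // (ext_fun k) //; exact: ext_laurent h hf.
Qed.

Lemma extends_auto_pushforward phi E E' a : extends_auto phi E E' -> Ahat P a ->
  is_pushforward P phi a (E a).
Proof.
move=> h ha; split=> [|d]; first exact: (ext_Ahat h ha).
rewrite -(ext_component h) //.
have hd : homog d (component d a) by exact: homog_component.
move: hd (Ahat_component d ha).
elim: d (component d a) => [|d IH] b db hb /=; first by rewrite (ext_fun h).
move=> f hf; have hf' := ext_laurent_inv h hf.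
rewrite (phi_invE h) // -{2}(extVK h hf.1) -(ext_act h) //; apply: IH.
  exact: act_homogS.
exact: Ahat_act hb hf'.1.
Qed.

End Pushforward.

(** * Wall crossings and the gluing of sections *)

Section WallCrossing.
Variables (K : realType) (r : nat) (R : comPzRingType) (P : set 'rV[int]_r).
Hypothesis P0 : P 0.
Hypothesis PD : forall x y, P x -> P y -> P (x + y).
Hypothesis P_separated : adically_separated P.
Variable iota : {rmorphism rat -> R}.
Variable br : pv r R -> pv r R -> pv r R.
Hypothesis brP : schouten_nijenhuis P br.

Lemma mpow_mulrn n k : P n -> n <> 0 -> mpow P k (n *+ k).
Proof.
move=> Pn n0; elim: k => [|k IH]; first by rewrite mulr0n.
by exists n, (n *+ k); split=> //; rewrite mulrS.
Qed.

(** Each coefficient of g agrees with that of a sufficiently late approximant, so the exponents of g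
    are multiples n k with k > 0. Since n is a nonzero element of P, n k lies in the k-th power,
    which yields both order 1 and the finiteness condition. *)
Lemma g_par_pseries n (g : pv r R) : P n -> n <> 0 -> g_par P n g ->
  pseries P 0 1 g.
Proof.
move=> Pn n0 [_ [u [[_ [m hm]] hu]]].
have supp p : g p <> 0 -> exists2 k, (0 < k)%N & p = n *+ k.
  move=> gp; have [k hk] := mpow_separated P_separated (p - m).
  have [J /(_ J (leqnn J))[hJ _]] := hm k.
  have guJ : g p = u J p.
    apply/eqP; rewrite -subr_eq0; apply/eqP; apply: contrapT => h; exact/hk/hJ.
  apply: contrapT => hp; apply: gp; rewrite guJ.
  have [l [s [x [hx ->]]]] := hu J; rewrite fct_sumE big1 // => i _.
  have [_ [k' [m' [k0 xE]]]] := hx i; rewrite !fctE xE /mono.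
  case: eqP => [pE|_]; last by rewrite scaler0.
  by case: hp; exists k'.
split=> [p /supp[k k0 ->]|j].
  by rewrite subr0; apply: (mpowW PD k0); exact: mpow_mulrn.
(* Exponents outside the j-th power can only be n k with k < j. *)
apply: (@sub_finite_set _ _ ((fun k => n *+ k) @` `I_j)); last first.
  exact/finite_image/finite_II.
move=> p [/supp[k k0 pE] hp]; exists k => //=.
rewrite ltnNge; apply/negP => jk; apply: hp; rewrite subr0 pE.
by apply: (mpowW PD jk); exact: mpow_mulrn.
Qed.

Lemma extends_auto_exp g : pseries P 0 1 g -> homog 1 g ->
  extends_auto P (exp_op P iota (act g)) (exp_op P iota (br g))
    (exp_op P iota (fun a => - br g a)).
Proof.
move=> hg dg; have Ag : Ahat P g by exact: (pseries_Ahat PD hg).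
have hD : filtered_op P (br g).
  split=> [n|n k a]; first exact: br_linear.
  exact: br_filtration.
have hN := filtered_opN hD.
have DNN : (fun a => - - br g a) = br g by apply/funext => a; rewrite opprK.
split.
- by move=> a; exact: Ahat_exp_op.
- by move=> a; exact: Ahat_exp_op.
(* The inverse on the other side is the same result applied to - D, using - - D = D. *)
- by move=> a ha; have := exp_opN PD P_separated iota hN ha; rewrite DNN.
- by move=> a; exact: exp_opN.
- move=> d a ha; apply: exp_op_component => // b hb.
  exact: (br_component (P := P)).
- move=> a f ha hf; apply: exp_op_act => // [h|b h hb] hh; first exact: br_laurent.
  exact: (br_act (P := P)).
(* On functions bracket and action have equal iterates, so the partial sums coincide and no limit
   argument is needed. *)
move=> f hf; congr adic_lim; apply/funext => J; apply: eq_bigr => j _.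
congr (_ *: _).
suff [] : iter j (act g) f = iter j (br g) f /\ laurent P (iter j (br g) f) by [].
elim: (j : nat) => //= i [-> hi]; split; last exact: br_laurent.
by rewrite (sn_fun brP).
Qed.

Lemma extends_auto_wall (d : wall r R K) : is_wall P d ->
  exists E', extends_auto P (wall_crossing P iota d) (ext_wall_crossing P iota br d) E'.
Proof.
move=> [_ Pd d0 hg]; eexists; apply: extends_auto_exp; last by case: hg => -[].
exact: g_par_pseries hg.
Qed.

(** Induction on the generation of phi, keeping the relation between the two local sections together
    with the extension: a crossing uses the gluing hypothesis, an inverse exchanges E and E', and a
    composite composes the extensions. *)
Lemma extends_auto_gluing (D : scattering R P K) (a : chamber D -> pv r R) s s' phi :
  glued iota br a -> gluing_iso iota s s' phi ->
  exists E E', extends_auto P phi E E' /\ a s' = E (a s).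
Proof.
move=> [hA hglue]; elim=> {s s' phi}.
- by move=> s; exists id, id; split=> //; exact: extends_auto_id.
- move=> s d s' hd; have [E' hE] := extends_auto_wall (crossing_wall hd).
  by exists (ext_wall_crossing P iota br d), E'; split=> //; exact: hglue.
- move=> s s' phi _ [E [E' [hE aE]]]; exists E', E; split.
    exact: extends_auto_inv.
  by rewrite aE (extK hE).
- move=> s s' s'' phi psi _ [E [E' [hE aE]]] _ [F [F' [hF aF]]].
  exists (F \o E), (E' \o F'); split; first exact: extends_auto_comp.
  by rewrite aF aE.
Qed.

End WallCrossing.

Theorem proposition5p7 (K : realType) (r : nat) (R : comPzRingType)
    (iota : {rmorphism rat -> R})
    (C : set 'rV[K]_r) (P : set 'rV[int]_r)
    (hC : strictly_convex_cone C) (hP : P = lattice_points C)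
    (hsep : adically_separated P)
    (br : pv r R -> pv r R -> pv r R) (hbr : schouten_nijenhuis P br) :
  (forall (d : wall r R K), is_wall P d ->
     forall a : pv r R, Ahat P a ->
       (exists! b, is_pushforward P (wall_crossing P iota d) a b) /\
       pushforward P (wall_crossing P iota d) a
       = ext_wall_crossing P iota br d a) /\
  (forall (D : scattering R P K) (a : chamber D -> pv r R),
     glued iota br a -> meromorphic_section iota a).
Proof.
have [C0 CD _ _] := hC.
have P0 : P 0 by rewrite hP /lattice_points /= map_mx0.
have PD x y : P x -> P y -> P (x + y).
  by rewrite hP /lattice_points /= map_mxD; exact: CD.
split=> [d hd a ha|D a ha].
  have [E' hE] := extends_auto_wall P0 PD hsep iota hbr hd.
  have hpush := extends_auto_pushforward PD hE ha.
  have uniq b : is_pushforward P (wall_crossing P iota d) a b ->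
      ext_wall_crossing P iota br d a = b.
    exact: (pushforward_unique P0 hpush).
  split; first by exists (ext_wall_crossing P iota br d a); split.
  by apply: xget_unique => // b /uniq.
split=> [|s s' phi hphi]; first exact: ha.1.
have [E [E' [hE ->]]] := extends_auto_gluing P0 PD hsep hbr ha hphi.
by apply: (extends_auto_pushforward PD hE); exact: ha.1.
Qed.
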